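(* Let $n\ge 1$, $0<p<\infty$ and $v_1,\dots,v_n\in\ell^p=\ell^p(\mathbb N)$. For each $n$-element set $I=\{i_1<\dots<i_n\}\subset\mathbb N$ put $p_I=\det\big(v_r(i_s)\big)_{r,s=1}^n$. Let $C_{n,p}$ denote the optimal constant in the inequality $$\big\|(p_I)_{I}\big\|_{p}\le C_{n,p}\prod_{r=1}^n\|v_r\|_p\qquad(v_1,\dots,v_n\in\ell^p).$$ Then $(p_I)_{I\in\mathcal I_n}\in\ell^p(\mathcal I_n)$, and: (a) For $1\le p<\infty$, $\ \|(p_I)\|_p\le (n!)^{1/p'}\prod_{r=1}^n\|v_r\|_p$, where $1/p+1/p'=1$. (b) For $0<p\le 1$ and for $p=2$, the constant is exactly $1$: $\|(p_I)\|_p\le\prod_{r=1}^n\|v_r\|_p$, with equality at $v_r=e_r$ (any $p$), and at orthonormal frames for $p=2$. (c) For $1\le p\le 2$ the constant is exactly $1$. (d) For $2<p<\infty$ the optimal constant $C_{n,p}$ satisfies $C_{n,p}\ge n^{\,n\left(\frac12-\frac1p\right)}>1$ whenever a Hadamard matrix of order $n$ exists; in general $C_{n,p}\ge h_n\,n^{-n/p}$, where $h_n$ is the maximal determinant of an $n\times n$ $\pm1$ matrix. (e) The exponent is sharp: for every $q<p$ there exist $v_1,\dots,v_n\in\ell^p$ with $(p_I)\notin\ell^q(\mathcal I_n)$.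
   Context: Scalars are complex. $\mathcal I_n=\binom{\mathbb N}{n}$ is the set of $n$-element subsets of $\mathbb N$. For an exponent $0<s<\infty$, $\ell^s(\mathcal I_n)$ is the space of families $(x_I)_{I\in\mathcal I_n}$ with $\|x\|_s=\big(\sum_I|x_I|^s\big)^{1/s}<\infty$ (a quasi-norm when $s<1$), and $\ell^s(\mathbb N)$ is defined likewise. $e_r$ denotes the $r$-th standard unit vector of $\ell^p(\mathbb N)$. For $p=1$ one reads $1/p'=0$. A Hadamard matrix of order $n$ is an $n\times n$ matrix $H$ with entries $\pm1$ and $HH^{\mathsf T}=nI$ (here $I$ is the identity matrix).
   Formalization: In (d), the strict inequality n^{n(1/2-1/p)} > 1 is asserted only for n ≥ 2: for n = 1 the matrix (1) is Hadamard and the quantity equals 1, so ''> 1'' fails there; the lower bound on C_{n,p} is kept for all n ≥ 1. *)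

(* Defs.v *)
From HB Require Import structures.
From mathcomp Require Import all_boot all_order all_algebra finmap.
From mathcomp Require Import complex.
From mathcomp Require Import all_classical all_reals all_analysis.

Set Implicit Arguments.
Unset Strict Implicit.
Unset Printing Implicit Defensive.

Import Order.TTheory GRing.Theory Num.Theory.
Import numFieldNormedType.Exports.

Local Open Scope classical_set_scope.
Local Open Scope ring_scope.

Definition nsubset (n : nat) : Type := {I : {fset nat} | #|` I|%fset == n}.
HB.instance Definition _ (n : nat) := Choice.on (nsubset n).

(* Meaningful for 0 < s; the value is +oo exactly when x is not in l^s(T).
   The order on R[i] makes `|z| an element of R[i], hence the use of normc. *)
Definition ell_norm (R : realType) (T : choiceType) (s : R) (x : T -> R[i]) :
    \bar R :=
  ((\esum_(i in [set: T]) ((Normc.normc (x i)) `^ s)%:E) `^ s^-1)%E.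

Definition in_ell (R : realType) (T : choiceType) (s : R) (x : T -> R[i]) :
    Prop :=
  (ell_norm s x < +oo)%E.

(* e_r, with nat indexed from 0. *)
Definition std_unit (R : realType) (r : nat) : nat -> R[i] :=
  fun k => (k == r)%:R.

(* The s-th smallest element of I, for s < n. *)
Definition nsubset_nth (n : nat) (I : nsubset n) (s : nat) : nat :=
  nth 0%N (sort leq (val I : {fset nat})) s.

Definition plucker (R : realType) (n : nat) (v : 'I_n -> nat -> R[i])
    (I : nsubset n) : R[i] :=
  \det (\matrix_(r < n, s < n) v r (nsubset_nth I s)).

Definition admissible_const (R : realType) (n : nat) (p : R) : set R :=
  [set C | forall v : 'I_n -> nat -> R[i], (forall r, in_ell p (v r)) ->
     (ell_norm p (plucker v) <= C%:E * \prod_(r < n) ell_norm p (v r))%E].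

Definition optimal_const (R : realType) (n : nat) (p C : R) : Prop :=
  admissible_const n p C /\ lbound (admissible_const n p) C.

(* The sum of v_r(k) times the conjugate of v_s(k) over k is delta_rs; R[i]^o
   carries the topology of the modulus. *)
Definition orthonormal_frame (R : realType) (n : nat)
    (v : 'I_n -> nat -> R[i]) : Prop :=
  forall r s : 'I_n,
    series (fun k => v r k * Num.conj (v s k) : R[i]^o) @ \oo
      --> ((r == s)%:R : R[i]^o).

Definition sign_mx (R : realType) (n : nat) (H : 'M[R]_n) : Prop :=
  forall i j, H i j = 1 \/ H i j = -1.

Definition hadamard_mx (R : realType) (n : nat) (H : 'M[R]_n) : Prop :=
  sign_mx H /\ H *m H^T = (n%:R)%:M.

(* The supremum of a finite nonempty set, so it is attained. *)
Definition max_sign_det (R : realType) (n : nat) : R :=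
  sup [set \det M | M in [set M : 'M[R]_n | sign_mx M]].

(* Main.v *)
(* For p <= 1 and for (a), expand each determinant over permutations and use
   subadditivity of t -> t^p, resp. the power mean inequality: summing over
   n-subsets and permutations is summing over injective maps 'I_n -> N, hence
   at most the product of the row sums. For p = 2, Cauchy-Binet turns the sum
   of squares into a Gram determinant, to which Hadamard's inequality applies.

   For 1 < p < 2 the constant 1 comes from interpolating between p = 1 and
   p = 2 the multiaffine form P(v, y) = sum_I y_I p_I(v). Instead of the three
   lines theorem, the bounds of P on two tori are transferred to the
   coefficients of P^m (by averaging over roots of unity), interpolated
   coefficient by coefficient, and summed up; the number of coefficients is
   polynomial in m, so it disappears after taking m-th roots. *)
Require Import Defs.
From HB Require Import structures.
From mathcomp Require Import all_boot all_order all_algebra finmap.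
From mathcomp Require Import complex.
From mathcomp Require Import fingroup perm cyclic separable cyclotomic.
From mathcomp Require Import sesquilinear spectral zify ring lra.
From mathcomp Require Import all_classical all_reals all_analysis.

Set Implicit Arguments.
Unset Strict Implicit.
Unset Printing Implicit Defensive.

Import Order.TTheory GRing.Theory Num.Theory.
Import numFieldNormedType.Exports.

Local Open Scope classical_set_scope.
Local Open Scope ring_scope.

Local Notation normc := Normc.normc.

(** * The real-valued modulus on [R[i]], and primitive roots of unity *)

Section NormC.
Variable R : realType.
Implicit Types (x y : R[i]).

Lemma normc_norm x : `|x| = ((normc x)%:C)%C.
Proof. by case: x. Qed.

Lemma normc_ge0 x : 0 <= normc x.
Proof. by case: x => a b; exact: sqrtr_ge0. Qed.

Lemma normc_sum (I : Type) (s : seq I) (P : pred I) (F : I -> R[i]) :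
  normc (\sum_(i <- s | P i) F i) <= \sum_(i <- s | P i) normc (F i).
Proof.
elim/big_ind2: _ => [|x a y b xa yb|//]; first by rewrite Normc.normc0.
by apply: le_trans (lerD xa yb); exact: le_normcD.
Qed.

Lemma normc_prod (I : Type) (s : seq I) (P : pred I) (F : I -> R[i]) :
  normc (\prod_(i <- s | P i) F i) = \prod_(i <- s | P i) normc (F i).
Proof. exact: (big_morph _ (@Normc.normcM R) (@Normc.normc1 R)). Qed.

Lemma normcX x m : normc (x ^+ m) = normc x ^+ m.
Proof.
elim: m => [|m IH]; first by rewrite !expr0 Normc.normc1.
by rewrite !exprS Normc.normcM IH.
Qed.

Lemma normc_real (a : R) : normc (a%:C)%C = `|a|.
Proof. by rewrite /= expr0n /= addr0 sqrtr_sqr. Qed.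

Lemma normc_nat m : normc (m%:R : R[i]) = m%:R.
Proof.
have -> : (m%:R : R[i]) = ((m%:R : R)%:C)%C by rewrite rmorph_nat.
by rewrite normc_real ger0_norm.
Qed.

Lemma normc_signM (b : bool) x : normc ((-1) ^+ b * x) = normc x.
Proof. by case: b; rewrite ?mul1r// expr1 mulN1r normcN. Qed.

Lemma normc_conj x : normc (Num.conj x) = normc x.
Proof. by case: x => a b /=; rewrite sqrrN. Qed.

Lemma normc_sqr x : ((normc x ^+ 2)%:C)%C = x * Num.conj x.
Proof. by rewrite rmorphXn /= -normc_norm -normCK. Qed.

(** ['X^m - 1] splits over the closed field [R[i]] and is separable, so it has [m] distinct roots,
    one of which must be primitive. *)
Lemma prim_root_exists m : (0 < m)%N ->
  exists z : R[i], m.-primitive_root z.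
Proof.
move=> m0; have [r Dp] := closed_field_poly_normal ('X^m - 1 : {poly R[i]}).
rewrite (monicP _) ?monicXnsubC // scale1r in Dp.
have rn1: all m.-unity_root r by apply/allP=> z; rewrite -root_prod_XsubC -Dp.
have sz_r: (m < (size r).+1)%N.
  by rewrite -(size_prod_XsubC r id) -Dp size_XnsubC.
have [|z] := hasP (has_prim_root m0 rn1 _ sz_r); last by exists z.
by rewrite -separable_prod_XsubC -Dp separable_Xn_sub_1 // pnatr_eq0 -lt0n.
Qed.

Lemma normc_unity_root m x : (0 < m)%N -> x ^+ m = 1 -> normc x = 1.
Proof.
move=> m0 xm; apply/eqP; rewrite -(@pexpr_eq1 _ _ m) ?normc_ge0 //.
by rewrite -normcX xm Normc.normc1.
Qed.

End NormC.

(** * Coefficient bounds by averaging over roots of unity; removal of polynomial factors *)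

Section Interpolation.
Variables (R : realType) (D : finType).
Implicit Types (z w : D -> R[i]) (a b : D -> R).

Lemma sum_unity_root (m : nat) (w : R[i]) : (0 < m)%N -> w ^+ m = 1 ->
  \sum_(s < m) w ^+ s = if w == 1 then m%:R else 0.
Proof.
move=> m0 wm; case: eqP => [->|/eqP w1].
  by rewrite (eq_bigr (fun=> 1)) ?sumr_const ?card_ord // => i _; rewrite expr1n.
apply/eqP; rewrite -(mulrI_eq0 _ (@mulfI _ (w - 1) _)) ?subr_eq0 //.
by rewrite -subrX1 wm subrr.
Qed.

(** Discrete Cauchy formula: averaging [Q] over the grid of points [z i * u ^+ s i], weighted by a
    character, isolates the monomial [f]. All exponents are at most [m], so a root [u] of order
    [m.+1] tells them apart. *)
Lemma cauchy_estimate (m : nat) (K : {ffun D -> 'I_m.+1} -> R[i]) z (B : R)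
    (Q := fun w => \sum_f K f * \prod_i w i ^+ f i) :
  (forall w, (forall i, normc (w i) = normc (z i)) -> normc (Q w) <= B) ->
  forall f, normc (K f) * \prod_i normc (z i) ^+ f i <= B.
Proof.
move=> QB f; have [u u_prim] := @prim_root_exists R m.+1 isT.
have uM : u ^+ m.+1 = 1 by exact: prim_expr_order.
have nu : normc u = 1 by exact: normc_unity_root uM.
pose w (s : {ffun D -> 'I_m.+1}) i := z i * u ^+ s i.
have nw s i : normc (w s i) = normc (z i).
  by rewrite Normc.normcM normcX nu expr1n mulr1.
(* The weight is [u] to the power [- s i * f i], written with natural exponents. *)
have E : \sum_(s : {ffun D -> 'I_m.+1})
      (\prod_i u ^+ (s i * (m.+1 - f i))) * Q (w s) =
    (m.+1 ^ #|D|)%:R * (K f * \prod_i z i ^+ f i).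
  under [LHS]eq_bigr => s _ do rewrite /Q mulr_sumr.
  rewrite exchange_big /= (bigD1 f) //= [X in _ + X]big1 ?addr0.
    under [LHS]eq_bigr => s _.
      rewrite mulrCA -big_split /=.
      under eq_bigr => i _.
        rewrite exprMn mulrCA -exprM -exprD -mulnDr subnK 1?ltnW //.
        rewrite mulnC exprM uM expr1n mulr1; over.
      over.
    by rewrite sumr_const card_ffun card_ord mulr_natl.
  move=> g gf.
  under [LHS]eq_bigr => s _.
    rewrite mulrCA -big_split /=.
    under eq_bigr => i _ do
      rewrite exprMn mulrCA -exprM -exprD -mulnDr mulnC exprM.
    rewrite big_split /= mulrA; over.
  rewrite -mulr_sumr.
  (* The sum over [s] factors into one geometric sum per coordinate, and the factor at a coordinate
     where [g] and [f] differ vanishes. *)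
  have := bigA_distr_bigA (fun i (j : 'I_m.+1) => (u ^+ (m.+1 - f i + g i)) ^+ j).
  move=> <-; have /existsP [i gfi] : [exists i, g i != f i].
    apply: contraR gf; rewrite negb_exists => /forallP gf.
    by apply/eqP/ffunP => i; apply/eqP; have := gf i; rewrite negbK.
  rewrite [X in _ * X](bigD1 i) //=.
  rewrite sum_unity_root //; last by rewrite exprAC uM expr1n.
  rewrite ifN ?mul0r ?mulr0 // -(prim_order_dvd u_prim).
  apply: contra gfi => d; apply/eqP/val_inj/eqP => /=.
  have : (f i + (m.+1 - f i + g i) == f i + 0 %[mod m.+1])%N.
    by rewrite eqn_modDl mod0n.
  by rewrite addnA subnKC 1?ltnW // modnDl addn0 !modn_small.
have Mpos : 0 < (m.+1 ^ #|D|)%:R :> R by rewrite ltr0n expn_gt0.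
rewrite -(ler_pM2l Mpos).
have -> : (m.+1 ^ #|D|)%:R * (normc (K f) * \prod_i normc (z i) ^+ f i) =
    normc (\sum_(s : {ffun D -> 'I_m.+1})
      (\prod_i u ^+ (s i * (m.+1 - f i))) * Q (w s)).
  rewrite E !Normc.normcM normc_nat normc_prod.
  by congr (_ * (_ * _)); apply: eq_bigr => i _; rewrite normcX.
apply: le_trans (normc_sum _ _ _) _.
have -> : (m.+1 ^ #|D|)%:R * B = \sum_(s : {ffun D -> 'I_m.+1}) B.
  by rewrite sumr_const card_ffun card_ord mulr_natl.
apply: ler_sum => s _; rewrite Normc.normcM normc_prod big1 ?mul1r; last first.
  by move=> i _; rewrite normcX nu expr1n.
by apply: QB => i; exact: nw.
Qed.

(** If [x / y = 1 + t] with [t > 0], Bernoulli's inequality makes the power of exponent [k * d.+1]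
    at least [(t * k) ^+ d.+1], one degree more in [k] than the polynomial factor allows. *)
Lemma le_of_subexp_growth (d : nat) (x y : R) : 0 <= x -> 0 <= y ->
  (forall m, x ^+ m <= (m.+1 ^ d)%:R * y ^+ m) -> x <= y.
Proof.
move=> x0 y0 H; rewrite leNgt; apply/negP => yx.
have [y00|ypos] := eqVneq y 0.
  by have := H 1%N; rewrite y00 expr1 mulr0 leNgt -y00 yx.
have {ypos}ypos : 0 < y by rewrite lt0r ypos.
pose t := x / y - 1.
have tpos : 0 < t by rewrite /t subr_gt0 ltr_pdivlMr // mul1r.
have xyE : x / y = 1 + t by rewrite /t addrC subrK.
clearbody t; have bern k : t * k%:R <= (x / y) ^+ k.
  rewrite xyE.
  elim: k => [|k IH]; first by rewrite mulr0 expr0.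
  have : 1 <= (1 + t) ^+ k by apply: exprn_ege1; rewrite lerDl ltW.
  rewrite exprS; move: IH; set X := (1 + t) ^+ k => IH X1.
  rewrite mulrDl mul1r -natr1 mulrDr mulr1 lerD //.
  by rewrite -[leLHS]mulr1 ler_pM2l.
have key k : (0 < k)%N -> t ^+ d.+1 * k%:R <= ((2 * d.+1) ^ d)%:R.
  move=> k0; have := H (k * d.+1)%N.
  rewrite -ler_pdivrMr ?exprn_gt0 // -expr_div_n exprM => /(le_trans _) K.
  have K1 : (t * k%:R) ^+ d.+1 <= ((k * d.+1).+1 ^ d)%:R.
    apply: K; rewrite lerXn2r ?nnegrE ?mulr_ge0 ?exprn_ge0 ?divr_ge0 //.
    exact: ltW.
  (* Bounding [(k * d.+1).+1] by [k * (2 * d.+1)] lets the factor [k ^ d] be cancelled. *)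
  have {}K1 : (t * k%:R) ^+ d.+1 <= ((k * (2 * d.+1)) ^ d)%:R.
    apply: le_trans K1 _; rewrite ler_nat.
    case: (d) => [|d']; first by rewrite !expn0.
    by rewrite leq_exp2r // mulnCA mul2n -addnn -addn1 leq_add2l muln_gt0 k0.
  have kd : 0 < k%:R ^+ d :> R by rewrite exprn_gt0 // ltr0n.
  rewrite -(ler_pM2r kd) -mulrA -exprS -exprMn; apply: le_trans K1 _.
  by rewrite expnMn natrM mulrC -natrX.
pose k := (Num.trunc (((2 * d.+1) ^ d)%:R / t ^+ d.+1)).+1.
have := key k isT; rewrite leNgt => /negP; apply.
by rewrite mulrC -ltr_pdivrMr ?exprn_gt0 // Num.Theory.truncnS_gt.
Qed.

End Interpolation.

Lemma powR_exprn (R : realType) (x s : R) m :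
  0 <= x -> (x `^ s) ^+ m = (x ^+ m) `^ s.
Proof.
move=> x0; elim: m => [|m IH]; first by rewrite !expr0 powR1.
by rewrite !exprS IH powRM // exprn_ge0.
Qed.

(** * Interpolation of a multiaffine polynomial between two tori *)

Section MultiaffineInterpolation.
Variables (R : realType) (D J : finType) (c : J -> R[i]) (e : J -> D -> bool).
Implicit Types (z w : D -> R[i]) (a b : D -> R).

Definition multiaffine z : R[i] := \sum_j c j * \prod_i z i ^+ e j i.

(** The expanded power has one term per choice [h] of [m] monomials, and these are grouped by total
    exponent. No exponent exceeds [m], since a variable occurs at most once in each monomial. *)
Lemma multiaffineX m : exists K : {ffun D -> 'I_m.+1} -> R[i],
  forall z, multiaffine z ^+ m = \sum_f K f * \prod_i z i ^+ f i.
Proof.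
pose deg (h : {ffun 'I_m -> J}) (i : D) := (\sum_k e (h k) i)%N.
have deg_le h i : (deg h i < m.+1)%N.
  rewrite ltnS; apply: (@leq_trans (\sum_(k < m) 1)).
    by apply: leq_sum => k _; exact: leq_b1.
  by rewrite sum_nat_const card_ord muln1.
pose degf h := [ffun i => Ordinal (deg_le h i)] : {ffun D -> 'I_m.+1}.
exists (fun f => \sum_(h | degf h == f) \prod_k c (h k)) => z.
rewrite -[m in LHS]card_ord -prodr_const /multiaffine bigA_distr_bigA /=.
rewrite (partition_big degf predT) //=; apply: eq_bigr => f _.
rewrite mulr_suml; apply: eq_bigr => h /eqP <-.
rewrite big_split /=; congr (_ * _); rewrite exchange_big /=.
by apply: eq_bigr => i _; rewrite ffunE /= -expr_sum.
Qed.

(* The hypotheses bound every coefficient of the [m]-th power of the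
   polynomial on both tori; there are only [m.+1 ^ #|D|] coefficients, so the
   [m]-th root of the resulting bound tends to the claim. *)
Lemma multiaffine_interpolation a b (A B t : R) :
  (forall i, 0 <= a i) -> (forall i, 0 <= b i) ->
  (forall z, (forall i, normc (z i) = a i) -> normc (multiaffine z) <= A) ->
  (forall z, (forall i, normc (z i) = b i) -> normc (multiaffine z) <= B) ->
  forall z, (forall i, normc (z i) = a i `^ (1 - t) * b i `^ t) ->
  0 <= t <= 1 ->
  normc (multiaffine z) <= A `^ (1 - t) * B `^ t.
Proof.
move=> a0 b0 hA hB z hz /andP[t0 t1].
pose za i : R[i] := ((a i)%:C)%C; pose zb i : R[i] := ((b i)%:C)%C.
have nza i : normc (za i) = a i by rewrite normc_real ger0_norm.
have nzb i : normc (zb i) = b i by rewrite normc_real ger0_norm.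
have A0 : 0 <= A := le_trans (normc_ge0 _) (hA _ nza).
have B0 : 0 <= B := le_trans (normc_ge0 _) (hB _ nzb).
apply: (@le_of_subexp_growth R #|D|); rewrite ?normc_ge0 ?mulr_ge0 ?powR_ge0 //.
move=> m; rewrite -normcX; have [K KE] := multiaffineX m.
rewrite KE; apply: le_trans (normc_sum _ _ _) _.
have -> : (m.+1 ^ #|D|)%:R * (A `^ (1 - t) * B `^ t) ^+ m =
  \sum_(f : {ffun D -> 'I_m.+1}) (A `^ (1 - t) * B `^ t) ^+ m.
  by rewrite sumr_const card_ffun card_ord mulr_natl.
apply: ler_sum => f _; rewrite Normc.normcM normc_prod.
have estA : normc (K f) * \prod_i a i ^+ f i <= A ^+ m.
  under eq_bigr => i _ do rewrite -nza.
  apply: cauchy_estimate => w hw; rewrite -KE normcX lerXn2r ?nnegrE ?normc_ge0 //.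
  by apply: hA => i; rewrite hw nza.
have estB : normc (K f) * \prod_i b i ^+ f i <= B ^+ m.
  under eq_bigr => i _ do rewrite -nzb.
  apply: cauchy_estimate => w hw; rewrite -KE normcX lerXn2r ?nnegrE ?normc_ge0 //.
  by apply: hB => i; rewrite hw nzb.
have pa0 : 0 <= \prod_i a i ^+ f i by apply: prodr_ge0 => i _; rewrite exprn_ge0.
have pb0 : 0 <= \prod_i b i ^+ f i by apply: prodr_ge0 => i _; rewrite exprn_ge0.
(* The modulus of each term at [z] is the weighted geometric mean of its moduli on the two tori. *)
have -> : normc (K f) * \prod_i normc (z i ^+ f i) =
   (normc (K f) * \prod_i a i ^+ f i) `^ (1 - t) *
   (normc (K f) * \prod_i b i ^+ f i) `^ t.
  rewrite !powRM ?normc_ge0 // mulrACA -powRD; last by rewrite subrK oner_eq0.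
  rewrite subrK powRr1 ?normc_ge0 //; congr (_ * _).
  have pw (g : D -> R) s : (forall i, 0 <= g i) ->
      (\prod_i g i ^+ f i) `^ s = \prod_i (g i `^ s) ^+ f i.
    move=> g0; rewrite [RHS](eq_bigr (fun i => (g i ^+ f i) `^ s)); last first.
      by move=> i _; rewrite powR_exprn.
    elim: (index_enum _) => [|i r IH]; first by rewrite !big_nil powR1.
    rewrite !big_cons powRM ?IH ?exprn_ge0 //.
    by apply: prodr_ge0 => j _; rewrite exprn_ge0.
  rewrite !pw // -big_split /=; apply: eq_bigr => i _.
  by rewrite normcX hz exprMn.
rewrite exprMn !powR_exprn // ler_pM ?powR_ge0 // ge0_ler_powR ?subr_ge0 //;
  by rewrite nnegrE ?mulr_ge0 ?exprn_ge0 ?normc_ge0.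
Qed.

End MultiaffineInterpolation.

(** * Minors indexed by increasing maps, and the Cauchy-Binet formula *)

Section Minors.
Variables (n N : nat).
Implicit Types (f g : {ffun 'I_n -> 'I_N}) (s : 'S_n).

(** Increasing maps encode the [n]-element subsets of an initial segment of the naturals, already
    listed in order. *)
Definition increasing g :=
  [forall i : 'I_n, forall j : 'I_n, (i < j)%N ==> (g i < g j)%N].

Lemma increasingP g :
  reflect (forall i j : 'I_n, (i < j)%N -> (g i < g j)%N) (increasing g).
Proof.
apply: (iffP forallP) => H i; last first.
  by apply/forallP => j; apply/implyP; exact: H.
by move=> j; have /forallP/(_ j)/implyP := H i.
Qed.

Lemma increasing_inj g : increasing g -> injective g.
Proof.
move/increasingP => gI i j gij; apply/val_inj/eqP; rewrite eqn_leq.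
by apply/andP; split; rewrite leqNgt; apply/negP => /gI; rewrite gij ltnn.
Qed.

Lemma increasing_sorted g :
  increasing g -> sorted ltn [seq val (g i) | i <- enum 'I_n].
Proof.
move/increasingP => gI.
apply: (@homo_sorted _ _ (fun i => val (g i)) (fun i j : 'I_n => i < j)%N) => //.
by have := iota_ltn_sorted 0 n; rewrite -val_enum_ord sorted_map.
Qed.

Lemma increasing_uniq g g' : increasing g -> increasing g' ->
  (forall i, exists j, g i = g' j) -> (forall i, exists j, g' i = g j) -> g = g'.
Proof.
move=> gI g'I H H'.
have E : [seq val (g i) | i <- enum 'I_n] = [seq val (g' i) | i <- enum 'I_n].
  apply: (irr_sorted_eq ltn_trans ltnn); try exact: increasing_sorted.
  move=> x; apply/mapP/mapP => -[i _ ->].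
    by have [j ->] := H i; exists j; rewrite ?mem_enum.
  by have [j ->] := H' i; exists j; rewrite ?mem_enum.
apply/ffunP => i; apply: val_inj.
by move/eq_in_map: E => /(_ i); rewrite mem_enum => ->.
Qed.

(** Sorting its values writes an injective map, in exactly one way, as an increasing map composed
    with a permutation. *)
Lemma sum_increasing_perm (M : nmodType) (phi : {ffun 'I_n -> 'I_N} -> M) :
  \sum_(g | increasing g) \sum_(s : 'S_n) phi [ffun i => g (s i)] =
  \sum_(f : {ffun 'I_n -> 'I_N} | injectiveb f) phi f.
Proof.
pose h (x : {ffun 'I_n -> 'I_N} * 'S_n) := [ffun i => x.1 (x.2 i)].
pose P := [pred x : {ffun 'I_n -> 'I_N} * 'S_n | increasing x.1].
have hinj : {in P &, injective h}.
  move=> [g s] [g' s']; rewrite !inE /= => gI g'I /ffunP E.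
  have Ei i : g (s i) = g' (s' i) by have := E i; rewrite !ffunE.
  have gg' : g = g'.
    apply: increasing_uniq => // i.
      by exists (s' (s^-1%g i)); rewrite -Ei permKV.
    by exists (s (s'^-1%g i)); rewrite Ei permKV.
  congr (_, _) => //; apply/permP => i; apply: (increasing_inj gI).
  by rewrite Ei gg'.
rewrite pair_big_dep /=.
transitivity (\sum_(x in P) phi (h x)); first by apply: eq_bigl => x; rewrite andbT.
rewrite -(big_imset _ hinj); apply: eq_bigl => f.
apply/imsetP/injectiveP => [[[g s] gI ->] i j|f_inj].
  by rewrite !ffunE /= => /(increasing_inj gI)/perm_inj.
pose le_ord (x y : 'I_N) := (x <= y)%N.
pose u := [tuple f i | i < n].
have u_uniq : uniq u by rewrite map_inj_uniq ?enum_uniq.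
have sz : size (sort le_ord u) == n by rewrite size_sort size_tuple.
have [s us] : exists s : 'S_n, u = [tuple tnth (Tuple sz) (s i) | i < n] :> seq _.
  by apply/tuple_permP; rewrite perm_sym perm_sort.
exists ([ffun i => tnth (Tuple sz) i], s); last first.
  apply/ffunP => i; rewrite !ffunE.
  by move/val_inj: us => /(congr1 (fun v => tnth v i)); rewrite !tnth_mktuple.
rewrite inE /=; apply/increasingP => i j ij; rewrite !ffunE !(tnth_nth (f i)) /=.
have srt : sorted ltn (map val (sort le_ord u)).
  rewrite ltn_sorted_uniq_leq map_inj_uniq; last exact: val_inj.
  rewrite sort_uniq u_uniq /= sorted_map; apply: sort_sorted.
  by move=> x y; exact: leq_total.
have ltsz (k : 'I_n) : (k < size (sort le_ord u))%N by rewrite (eqP sz).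
have := sorted_ltn_nth ltn_trans 0%N srt i j.
by rewrite !inE !size_map !ltsz !(nth_map (f i)) //; apply.
Qed.

(** Arbitrary maps [f] are allowed so that antisymmetry in the columns can be stated and sums can
    run over all maps. *)
Definition minor (A : comPzRingType) (V : 'I_n -> 'I_N -> A) f : A :=
  \det (\matrix_(r < n, s < n) V r (f s)).

Lemma minor_perm (A : comPzRingType) (V : 'I_n -> 'I_N -> A) f s :
  minor V [ffun i => f (s i)] = (-1) ^+ s * minor V f.
Proof.
rewrite /minor.
have -> : \matrix_(r, s0) V r ([ffun i => f (s i)] s0) =
    col_perm s (\matrix_(r, s0) V r (f s0)).
  by apply/matrixP => i j; rewrite !mxE ffunE.
by rewrite col_permE det_mulmx det_perm odd_permV mulrC.
Qed.

Lemma minor_noninj (A : comPzRingType) (V : 'I_n -> 'I_N -> A) f :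
  ~~ injectiveb f -> minor V f = 0.
Proof.
case/injectivePn => i [j ij fij]; rewrite /minor -det_tr.
by apply: (determinant_alternate ij) => k; rewrite !mxE fij.
Qed.

Lemma minorE (A : comPzRingType) (V : 'I_n -> 'I_N -> A) f :
  minor V f = \sum_(s : 'S_n) (-1) ^+ s * \prod_r V r (f (s r)).
Proof.
apply: eq_bigr => s _; congr (_ * _).
by apply: eq_bigr => i _; rewrite mxE.
Qed.

(** Expanding only the minor of [V], and absorbing the sign into that of [W], turns the left side
    into a sum over injective maps. Non-injective maps contribute zero, so the sum extends to all
    maps and factors by distributivity. *)
Lemma cauchy_binet (A : comPzRingType) (V W : 'I_n -> 'I_N -> A) :
  \sum_(g | increasing g) minor V g * minor W g =
  \det (\matrix_(r, s) \sum_k V r k * W s k).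
Proof.
pose phi f := (\prod_r V r (f r)) * minor W f.
transitivity (\sum_(g | increasing g) \sum_(s : 'S_n) phi [ffun i => g (s i)]).
  apply: eq_bigr => g _; rewrite minorE mulr_suml; apply: eq_bigr => s _.
  rewrite /phi minor_perm mulrCA mulrA; congr (_ * _ * _).
  by apply: eq_bigr => r _; rewrite ffunE.
rewrite sum_increasing_perm big_mkcond /=.
transitivity (\sum_f phi f).
  apply: eq_bigr => f _; case: ifP => // /negbT f_ninj.
  by rewrite /phi minor_noninj // mulr0.
under eq_bigr => f _ do rewrite /phi /minor -det_tr mulr_sumr.
rewrite exchange_big; apply: eq_bigr => s _ /=.
under eq_bigr => f _ do rewrite mulrCA -big_split /=.
rewrite -mulr_sumr; congr (_ * _).
under [RHS]eq_bigr => r _ do rewrite mxE.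
rewrite bigA_distr_bigA; apply: eq_bigr => f _.
by apply: eq_bigr => r _; rewrite !mxE.
Qed.

End Minors.

(** * Finite bounds: Gram determinants, subadditivity and power means *)

Section FiniteBounds.
Variable R : realType.

Local Open Scope sesquilinear_scope.

Lemma conj_sum_sqr (n N : nat) (V : 'I_n -> 'I_N -> R[i]) :
  ((\sum_(g | increasing g) normc (minor V g) ^+ 2)%:C)%C =
  \det (\matrix_(r, s) \sum_k V r k * Num.conj (V s k)).
Proof.
rewrite -cauchy_binet rmorph_sum /=; apply: eq_bigr => g _.
rewrite normc_sqr; congr (_ * _); rewrite /minor -det_map_mx /=.
by congr (\det _); apply/matrixP => i j; rewrite !mxE.
Qed.

(* With [A = T *m B], [B] orthonormal and [T] triangular (Gram-Schmidt),
   the Gram determinant is the product of the [`|T i i| ^+ 2]. *)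
Lemma gram_det_le (C : numClosedFieldType) (n N : nat) (A : 'M[C]_(n, N)) :
  (n <= N)%N ->
  \det (A *m A ^t*) <= \prod_i \sum_k `|A i k| ^+ 2.
Proof.
move=> nN; pose B := schmidt A; have Bu : B *m B ^t* = 1%:M.
  exact/unitarymxP/schmidt_unitarymx.
pose T := A *m B ^t*.
have AT : A = T *m B.
  have /submxP [U AU] : (A <= B)%MS := schmidt_sub A.
  by rewrite /T {2}AU -(mulmxA U) Bu mulmx1; exact: AU.
have Ttrig : is_trig_mx T.
  apply/is_trig_mxP => i j ij.
  (* Row [i] of [A] is spanned by the rows [k <= i] of [B], all orthogonal to row [j] of [B] when
     [i < j]. *)
  have /sub_sumsmxP [u uE] := row_schmidt_sub A i.
  have -> : T i j = (row i A *m B ^t*) 0 j by rewrite -row_mul [RHS]mxE.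
  rewrite uE mulmx_suml summxE big1 // => k ki.
  have /submxP [d ->] : (u k *m <<row k B>> <= row k B)%MS.
    by apply: submx_trans (submxMl _ _) _; rewrite genmxE.
  rewrite -mulmxA -row_mul Bu !mxE big_ord1 !mxE.
  by rewrite -val_eqE /= ltn_eqF ?mulr0 //; exact: leq_ltn_trans ij.
have AA : A *m A ^t* = T *m T ^t*.
  by rewrite {1 2}AT trmx_mul map_mxM mulmxA -(mulmxA T) Bu mulmx1.
rewrite AA det_mulmx det_map_mx det_tr (det_trig Ttrig) rmorph_prod -big_split /=.
apply: ler_prod => i _; rewrite -normCK exprn_ge0 //=.
(* The squared row norms of [A] and of [T] are the diagonal of the same Gram matrix, and a row norm
   of [T] dominates the diagonal entry. *)
have -> : \sum_k `|A i k| ^+ 2 = \sum_k `|T i k| ^+ 2.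
  have diagE m (M : 'M[C]_(n, m)) : \sum_k `|M i k| ^+ 2 = (M *m M ^t*) i i.
    by rewrite mxE; apply: eq_bigr => k _; rewrite !mxE normCK.
  by rewrite !diagE AA.
by rewrite (bigD1 i) //= lerDl sumr_ge0 // => k _; rewrite exprn_ge0.
Qed.

Lemma increasing_leq (n N : nat) (g : {ffun 'I_n -> 'I_N}) :
  increasing g -> (n <= N)%N.
Proof. by move/increasing_inj/leq_card; rewrite !card_ord. Qed.

Lemma sum_minor_sqr_le (n N : nat) (V : 'I_n -> 'I_N -> R[i]) :
  \sum_(g | increasing g) normc (minor V g) ^+ 2 <=
  \prod_r \sum_k normc (V r k) ^+ 2.
Proof.
have [nN|Nn] := leqP n N; last first.
  rewrite [leLHS]big_pred0 => [|g].
    by apply: prodr_ge0 => r _; apply: sumr_ge0 => k _; rewrite exprn_ge0 ?normc_ge0.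
  by apply: contraTF Nn => /increasing_leq; rewrite -leqNgt.
rewrite -lecR conj_sum_sqr rmorph_prod.
have := gram_det_le (\matrix_(r, k) V r k) nN.
set G := (X in \det X <= _).
have -> : G = \matrix_(r, s) \sum_k V r k * Num.conj (V s k).
  by apply/matrixP => i j; rewrite !mxE; apply: eq_bigr => k _; rewrite !mxE.
move=> /le_trans; apply; apply: ler_prod => r _; apply/andP; split.
  by apply: sumr_ge0 => k _; rewrite exprn_ge0.
rewrite rmorph_sum; apply: ler_sum => k _.
by rewrite mxE normc_norm rmorphXn.
Qed.

Lemma normc_minor_le (n N : nat) (V : 'I_n -> 'I_N -> R[i]) g :
  normc (minor V g) <= \sum_(s : 'S_n) \prod_r normc (V r (g (s r))).
Proof.
rewrite minorE; apply: le_trans (normc_sum _ _ _) _.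
by apply: ler_sum => s _; rewrite normc_signM normc_prod.
Qed.

Lemma sum_perm_prod_le (n N : nat) (F : 'I_n -> 'I_N -> R) :
  (forall r k, 0 <= F r k) ->
  \sum_(g : {ffun 'I_n -> 'I_N} | increasing g)
     \sum_(s : 'S_n) \prod_r F r (g (s r)) <= \prod_r \sum_k F r k.
Proof.
move=> F0; pose phi (f : {ffun 'I_n -> 'I_N}) := \prod_r F r (f r).
have -> : \sum_(g : {ffun 'I_n -> 'I_N} | increasing g)
    \sum_(s : 'S_n) \prod_r F r (g (s r)) =
  \sum_(g | increasing g) \sum_(s : 'S_n) phi [ffun i => g (s i)].
  apply: eq_bigr => g _; apply: eq_bigr => s _.
  by apply: eq_bigr => r _; rewrite ffunE.
rewrite sum_increasing_perm bigA_distr_bigA /= big_mkcond.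
by apply: ler_sum => f _; case: ifP => // _; rewrite prodr_ge0.
Qed.

(** Each induction step divides by the total and applies u <= u^p on [0, 1] to two fractions with
    sum one. *)
Lemma powR_sum_le (I : Type) (s : seq I) (F : I -> R) (p : R) :
  0 < p <= 1 -> (forall i, 0 <= F i) ->
  (\sum_(i <- s) F i) `^ p <= \sum_(i <- s) F i `^ p.
Proof.
move=> /andP[p0 p1] F0; elim: s => [|i s IH].
  by rewrite !big_nil powR0 // gt_eqF.
rewrite !big_cons; set S := \sum_(j <- s) F j.
have S0 : 0 <= S by rewrite sumr_ge0.
apply: le_trans (lerD (lexx (F i `^ p)) IH); rewrite -/S.
have [T0|Tpos] := eqVneq (F i + S) 0.
  by rewrite T0 powR0 ?gt_eqF // addr_ge0 ?powR_ge0.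
have {}Tpos : 0 < F i + S by rewrite lt0r Tpos addr_ge0.
have key x : 0 <= x -> x <= F i + S ->
    x / (F i + S) * (F i + S) `^ p <= x `^ p.
  move=> x0 xT; have [->|xn0] := eqVneq x 0; first by rewrite !mul0r powR_ge0.
  have xpos : 0 < x by rewrite lt0r xn0.
  have : x / (F i + S) <= (x / (F i + S)) `^ p.
    by apply: ger1_powR; rewrite ?divr_gt0 //= ler_pdivrMr // mul1r.
  have TP : 0 <= (F i + S) `^ p by exact: powR_ge0.
  move=> /(ler_wpM2r TP) /le_trans; apply.
  by rewrite -powRM ?divr_ge0 ?(ltW Tpos) // divfK ?gt_eqF.
have := lerD (key _ (F0 i) _) (key _ S0 _); rewrite -mulrDl -mulrDl divff ?gt_eqF //.
by rewrite mul1r; apply; rewrite ?lerDl ?lerDr.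
Qed.

(** For [p > 1], Young's inequality is applied to each [F i] against m^(p-1), where [m] is the mean.
    Summed over [i], it says that [#|I|] times m^p is at most the sum of the [p]-th powers. *)
Lemma power_mean (I : finType) (F : I -> R) (p : R) :
  1 <= p -> (forall i, 0 <= F i) ->
  (\sum_i F i) `^ p <= #|I|%:R `^ (p - 1) * \sum_i F i `^ p.
Proof.
move=> p1 F0; have p0 : 0 < p by exact: lt_le_trans p1.
have [/eqP cI|cI] := posnP #|I|.
  rewrite !big_pred0 ?powR0 ?mulr0 ?gt_eqF // => i;
    by have := max_card (pred1 i); rewrite card1 (eqP cI).
have N0 : 0 < #|I|%:R :> R by rewrite ltr0n.
have [->|pn1] := eqVneq p 1.
  rewrite subrr powRr0 mul1r powRr1 ?sumr_ge0 //.
  by apply: ler_sum => i _; rewrite powRr1.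
have {pn1}p1' : 1 < p by rewrite lt_neqAle eq_sym pn1.
pose q := p / (p - 1).
have pm1 : 0 < p - 1 by rewrite subr_gt0.
have q0 : 0 < q by rewrite divr_gt0.
have pq : p^-1 + q^-1 = 1 by rewrite /q; field; rewrite !gt_eqF.
pose S := \sum_i F i; pose m := S / #|I|%:R.
have S0 : 0 <= S by rewrite sumr_ge0.
have m0 : 0 <= m by rewrite divr_ge0 // ltW.
have SE : S = #|I|%:R * m by rewrite mulrC divfK // gt_eqF.
have young i : F i * m `^ (p - 1) <= F i `^ p / p + m `^ p / q.
  have := conjugate_powR (F0 i) (powR_ge0 m (p - 1)) p0 q0 pq.
  by rewrite -powRrM /q mulrCA divff ?gt_eqF // mulr1.
have : \sum_i F i * m `^ (p - 1) <= \sum_i (F i `^ p / p + m `^ p / q).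
  by apply: ler_sum.
rewrite -mulr_suml -/S big_split /= sumr_const.
rewrite -[_ *+ #|xpredT|]mulr_natl -mulr_suml SE -mulrA mulr_powRB1 //.
rewrite -lerBlDr -mulrBr.
have -> : m `^ p - m `^ p / q = m `^ p / p.
  by rewrite -[X in X - _]mulr1 -mulrBr -pq addrK.
rewrite mulrA ler_pM2r ?invr_gt0 // => H.
rewrite powRM ?(ltW N0) // -(mulr_powRB1 (ltW N0) p0) mulrAC [leLHS]mulrC.
by rewrite ler_pM2l ?powR_gt0.
Qed.

End FiniteBounds.

Lemma powR_prod (R : realType) (I : Type) (s : seq I) (P : pred I)
    (F : I -> R) (p : R) :
  (forall i, P i -> 0 <= F i) ->
  (\prod_(i <- s | P i) F i) `^ p = \prod_(i <- s | P i) F i `^ p.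
Proof.
move=> F0; elim: s => [|i s IH]; first by rewrite !big_nil powR1.
by rewrite !big_cons; case: ifP => // Pi; rewrite powRM ?IH ?F0 ?prodr_ge0.
Qed.

(** * The inequality for finite matrices, one range of exponents at a time *)

Section FiniteInequality.
Variables (R : realType) (n N : nat).
Implicit Types (V : 'I_n -> 'I_N -> R[i]) (g : {ffun 'I_n -> 'I_N}).

Lemma sum_minor_powR_le_1 V (p : R) : 0 < p <= 1 ->
  \sum_(g | increasing g) normc (minor V g) `^ p <=
  \prod_r \sum_k normc (V r k) `^ p.
Proof.
move=> p01; have /andP[p0 p1] := p01.
apply: le_trans (sum_perm_prod_le (fun r k => powR_ge0 _ _)).
apply: ler_sum => g _.
have le_powR := ge0_ler_powR (ltW p0) (normc_ge0 (minor V g)).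
apply: le_trans (le_powR _ _ (normc_minor_le V g)) _.
  by rewrite nnegrE sumr_ge0 // => s _; rewrite prodr_ge0 // => r _; exact: normc_ge0.
apply: le_trans (powR_sum_le _ p01 _) _.
  by move=> s; rewrite prodr_ge0 // => r _; exact: normc_ge0.
by apply: ler_sum => s _; rewrite powR_prod // => r _; exact: normc_ge0.
Qed.

Lemma sum_minor_powR_ge_1 V (p : R) : 1 <= p ->
  \sum_(g | increasing g) normc (minor V g) `^ p <=
  n`!%:R `^ (p - 1) * \prod_r \sum_k normc (V r k) `^ p.
Proof.
move=> p1; have p0 : 0 <= p := le_trans ler01 p1.
apply: le_trans (ler_wpM2l (powR_ge0 _ _) (sum_perm_prod_le (fun r k => powR_ge0 _ _))).
rewrite mulr_sumr; apply: ler_sum => g _.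
have le_powR := ge0_ler_powR p0 (normc_ge0 (minor V g)).
apply: le_trans (le_powR _ _ (normc_minor_le V g)) _.
  by rewrite nnegrE sumr_ge0 // => s _; rewrite prodr_ge0 // => r _; exact: normc_ge0.
apply: le_trans (power_mean p1 _) _.
  by move=> s; rewrite prodr_ge0 // => r _; exact: normc_ge0.
have -> : #|{: 'S_n}| = n`! by rewrite card_Sn.
apply: ler_wpM2l; first exact: powR_ge0.
by apply: ler_sum => s _; rewrite powR_prod // => r _; exact: normc_ge0.
Qed.

(** One signed monomial per increasing map [j.1] and permutation [j.2]; the other pairs get
    coefficient zero, so that the index type is a plain product. *)
Definition pairing_coef (j : {ffun 'I_n -> 'I_N} * 'S_n) : R[i] :=
  if increasing j.1 then (-1) ^+ j.2 else 0.

(** The variables are the matrix entries [inl (r, k)] and one dual variable [inr g] for each map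
    [g]. *)
Definition pairing_supp (j : {ffun 'I_n -> 'I_N} * 'S_n)
    (i : 'I_n * 'I_N + {ffun 'I_n -> 'I_N}) : bool :=
  match i with inl rk => rk.2 == j.1 (j.2 rk.1) | inr g => g == j.1 end.

Lemma multiaffine_pairing (z : 'I_n * 'I_N + {ffun 'I_n -> 'I_N} -> R[i]) :
  multiaffine pairing_coef pairing_supp z =
  \sum_(g | increasing g) z (inr g) * minor (fun r k => z (inl (r, k))) g.
Proof.
rewrite /multiaffine [RHS]big_mkcond /=.

transitivity (\sum_g \sum_s pairing_coef (g, s) *
    \prod_i z i ^+ pairing_supp (g, s) i).
  by rewrite pair_big /=; apply: eq_bigr => -[].
apply: eq_bigr => g _; rewrite minorE mulr_sumr /pairing_coef /=.
case: ifP => _; last first.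
  by rewrite big1 // => s _; rewrite mul0r.
apply: eq_bigr => s _; rewrite big_sumType /= [RHS]mulrCA; congr (_ * _).
rewrite mulrC; congr (_ * _).
  rewrite (bigD1 g) //= eqxx expr1 big1 ?mulr1 // => g' /negbTE ->.
  by rewrite expr0.
transitivity (\prod_r \prod_k z (inl (r, k)) ^+ (k == g (s r))).
  by rewrite pair_big /=; apply: eq_bigr => -[].
apply: eq_bigr => r _; rewrite (bigD1 (g (s r))) //= eqxx expr1 big1 ?mulr1 //.
by move=> k /negbTE ->; rewrite expr0.
Qed.

Lemma cauchy_schwarz_sum (I : Type) (s : seq I) (P : pred I) (F G : I -> R) :
  (\sum_(i <- s | P i) F i * G i) ^+ 2 <=
  (\sum_(i <- s | P i) F i ^+ 2) * (\sum_(i <- s | P i) G i ^+ 2).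
Proof.
set T := \sum_(i <- s | P i) F i * G i.
set X := \sum_(i <- s | P i) F i ^+ 2; set Y := \sum_(i <- s | P i) G i ^+ 2.
have quad x : 0 <= x ^+ 2 * X + 2 * x * T + Y.
  have -> : x ^+ 2 * X + 2 * x * T + Y =
      \sum_(i <- s | P i) (x * F i + G i) ^+ 2.
    rewrite !mulr_sumr -!big_split /=; apply: eq_bigr => i _; ring.
  by apply: sumr_ge0 => i _; exact: sqr_ge0.
have X0 : 0 <= X by apply: sumr_ge0 => i _; exact: sqr_ge0.
have [X00|Xn0] := eqVneq X 0.
  have [->|T0] := eqVneq T 0; first by rewrite expr0n X00 mul0r.
  (* For [X = 0] the quadratic is affine, and at this point it would take the value [-1]. *)
  have := quad (- (Y + 1) / (2 * T)).
  have -> : (- (Y + 1) / (2 * T)) ^+ 2 * X + 2 * (- (Y + 1) / (2 * T)) * T + Y = - 1.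
    by rewrite X00; field.
  by rewrite oppr_ge0 ler10.
have := quad (- T / X).
have -> : (- T / X) ^+ 2 * X + 2 * (- T / X) * T + Y = (X * Y - T ^+ 2) / X.
  by field.
by rewrite pmulr_lge0 ?invr_gt0 ?lt0r ?Xn0 // subr_ge0.
Qed.

(** With [S] and [W] the two sides, the form is at most [W] on one torus, by expanding determinants,
    and at most (S W)^(1/2) on the other, by Cauchy-Schwarz and the case of exponent two. Its value
    at [z] is [S], so S <= W^(1-t) (S W)^(t/2), and cancelling the power of [S] leaves the claim. *)
Lemma sum_minor_powR_1_2 V (p : R) : 1 < p < 2 ->
  \sum_(g | increasing g) normc (minor V g) `^ p <=
  \prod_r \sum_k normc (V r k) `^ p.
Proof.
move=> /andP[p1 p2]; have p0 : 0 < p := lt_trans ltr01 p1.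
set S := \sum_(g | _) _; set W := \prod_r _.
have S0 : 0 <= S by rewrite sumr_ge0 // => g _; exact: powR_ge0.
have W0 : 0 <= W.
  by rewrite prodr_ge0 // => r _; rewrite sumr_ge0 // => k _; exact: powR_ge0.
pose mu g := normc (minor V g).
have mu0 g : 0 <= mu g by exact: normc_ge0.
(* On the entries, the powers [p] and [p / 2] make the row sums of moduli on the first torus and of
   squared moduli on the second both equal to those in [W]. *)
pose a (i : 'I_n * 'I_N + {ffun 'I_n -> 'I_N}) :=
  match i with inl rk => normc (V rk.1 rk.2) `^ p | inr g => 1 end.
pose b (i : 'I_n * 'I_N + {ffun 'I_n -> 'I_N}) :=
  match i with inl rk => normc (V rk.1 rk.2) `^ (p / 2)
             | inr g => mu g `^ (p / 2) end.
(* [1 - t / 2 = p^-1], so that [1 / p] lies at parameter [t] between [1] and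
   [1 / 2]. *)
pose t := 2 - 2 / p.
(* The dual variable at [g] is the norming one: its product with the minor is the [p]-th power of
   [mu g]. *)
pose z (i : 'I_n * 'I_N + {ffun 'I_n -> 'I_N}) : R[i] :=
  match i with inl rk => V rk.1 rk.2
             | inr g => Num.conj (minor V g) * ((mu g `^ (p - 2))%:C)%C end.
have a0 i : 0 <= a i by case: i => [rk|g] /=; rewrite ?powR_ge0.
have b0 i : 0 <= b i by case: i => [rk|g] /=; rewrite ?powR_ge0.
have sq_half x : 0 <= x -> (x `^ (p / 2)) ^+ 2 = x `^ p.
  by move=> x0; rewrite -powR_mulrn ?powR_ge0 // -powRrM divfK.
have bA w : (forall i, normc (w i) = a i) ->
    normc (multiaffine pairing_coef pairing_supp w) <= W.
  move=> wa; rewrite multiaffine_pairing; apply: le_trans (normc_sum _ _ _) _.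
  apply: le_trans (sum_perm_prod_le (fun r k => powR_ge0 (normc (V r k)) p)).
  apply: ler_sum => g _; rewrite Normc.normcM wa mul1r.
  apply: le_trans (normc_minor_le _ _) _.
  by apply: ler_sum => s _; under eq_bigr => r _ do rewrite wa.
have bB w : (forall i, normc (w i) = b i) ->
    normc (multiaffine pairing_coef pairing_supp w) <= (S * W) `^ 2^-1.
  move=> wb; rewrite powR12_sqrt ?mulr_ge0 //.
  rewrite -[leLHS]ger0_norm ?normc_ge0 // -sqrtr_sqr ler_wsqrtr //.
  rewrite multiaffine_pairing.
  apply: (@le_trans _ _ ((\sum_(g | increasing g) normc (w (inr g)) *
      normc (minor (fun r k => w (inl (r, k))) g)) ^+ 2)).
    rewrite lerXn2r ?nnegrE ?normc_ge0 //.
      by rewrite sumr_ge0 // => g _; rewrite mulr_ge0 ?normc_ge0.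
    apply: le_trans (normc_sum _ _ _) _.
    by apply: ler_sum => g _; rewrite Normc.normcM.
  apply: le_trans (cauchy_schwarz_sum _ _ _ _) _.
  apply: ler_pM; try by apply: sumr_ge0 => g _; rewrite exprn_ge0 ?normc_ge0.
    by apply: ler_sum => g _; rewrite wb sq_half.
  apply: le_trans (sum_minor_sqr_le _) _.
  rewrite le_eqVlt; apply/orP; left; apply/eqP; apply: eq_bigr => r _.
  by apply: eq_bigr => k _; rewrite wb /= sq_half ?normc_ge0.
have p_neq0 : p != 0 by rewrite gt_eqF.
have t01 : 0 <= t <= 1.
  have [pV1 pV2] : p^-1 < 1 /\ 2^-1 < p^-1.
    by split; rewrite ?invf_lt1 // ltf_pV2 ?posrE.
  by rewrite /t; apply/andP; split; lra.
have hz i : normc (z i) = a i `^ (1 - t) * b i `^ t.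
  case: i => [[r k]|g] /=.
    rewrite -!powRrM -powRD.
      have -> : p * (1 - t) + p / 2 * t = 1 by rewrite /t; field.
      by rewrite powRr1 ?normc_ge0.
    have -> : p * (1 - t) + p / 2 * t = 1 by rewrite /t; field.
    by rewrite oner_eq0.
  rewrite powR1 mul1r -powRrM Normc.normcM normc_conj normc_real ger0_norm ?powR_ge0 //.
  have -> : p / 2 * t = p - 1 by rewrite /t; field.
  have -> : p - 2 = p - 1 - 1 by ring.
  by rewrite mulr_powRB1 ?normc_ge0 ?subr_gt0.
have := multiaffine_interpolation a0 b0 bA bB hz t01.
have -> : normc (multiaffine pairing_coef pairing_supp z) = S.
  rewrite multiaffine_pairing.
  have -> : \sum_(g | increasing g) z (inr g) * minor (fun r k => z (inl (r, k))) g =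
      ((S)%:C)%C.
    rewrite rmorph_sum; apply: eq_bigr => g _ /=.
    have -> : minor (fun r k => V r k) g = minor V g by [].
    rewrite mulrAC [_ * minor V g]mulrC -normc_sqr -rmorphM /= -/(mu g).
    (* The exponent is raised by one twice, to [p - 1] and then to [p]; both are positive, so
       vanishing minors are covered. *)
    congr ((_)%:C)%C; rewrite expr2 -mulrA.
    have -> : p - 2 = p - 1 - 1 by ring.
    by rewrite mulr_powRB1 ?subr_gt0 // mulr_powRB1.
  by rewrite normc_real ger0_norm.
move=> H; have [->//|Sn0] := eqVneq S 0.
have Spos : 0 < S by rewrite lt0r Sn0.
have {}H : S `^ p^-1 <= W `^ p^-1.
  have E : 2^-1 * t = 1 - p^-1 by rewrite /t; field.
  have Sp : 0 < S `^ (1 - p^-1) by exact: powR_gt0.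
  rewrite -(ler_pM2r Sp) -powRD; last by rewrite addrC subrK oner_eq0.
  rewrite addrC subrK powRr1 //; apply: le_trans H _.
  rewrite -powRrM E powRM // mulrCA mulrC ler_wpM2r ?powR_ge0 //.
  have [->|Wn0] := eqVneq W 0.
    by rewrite [X in _ * X]powR0 ?mulr0 ?powR_ge0 // subr_eq0 eq_sym invr_eq1 gt_eqF.
  by rewrite -powRD ?Wn0 ?implybT // /t le_eqVlt; apply/orP; left; apply/eqP;
    congr (_ `^ _); field.
have := ge0_ler_powR (ltW p0) (powR_ge0 _ _) (powR_ge0 _ _) H.
by rewrite -!powRrM mulVf // !powRr1.
Qed.

End FiniteInequality.

(** * The [ell_norm] in terms of finite partial sums *)

Section EllNorm.
Variables (R : realType) (T : choiceType) (p : R) (p_gt0 : 0 < p).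
Implicit Types (x : T -> R[i]) (s : seq T).

Local Notation psum x s := (\sum_(i <- s) normc (x i) `^ p).
Local Notation total x := (\esum_(i in [set: T]) (normc (x i) `^ p)%:E)%E.

Lemma psum_ge0 x s : 0 <= psum x s.
Proof. by rewrite sumr_ge0 // => i _; exact: powR_ge0. Qed.

Lemma psum_le_total x s : uniq s -> ((psum x s)%:E <= total x)%E.
Proof.
move=> us; apply: esum_ge; exists [set` s]; first by split.
by rewrite -sumEFin fsbig_seq.
Qed.

Lemma total_ge0 x : (0 <= total x)%E.
Proof. by apply: esum_ge0 => i _; rewrite lee_fin powR_ge0. Qed.

Lemma psum_le_ell_norm x s : uniq s ->
  (((psum x s) `^ p^-1)%:E <= ell_norm p x)%E.
Proof.
move=> us; rewrite -poweR_EFin; apply: gt0_ler_poweR.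
- by rewrite invr_ge0 ltW.
- by rewrite in_itv /= leey andbT lee_fin psum_ge0.
- by rewrite in_itv /= leey andbT total_ge0.
- exact: psum_le_total.
Qed.

Lemma ell_norm_le x (S : R) : (forall s, uniq s -> psum x s <= S) ->
  (ell_norm p x <= (S `^ p^-1)%:E)%E.
Proof.
move=> xS; have S0 : 0 <= S by apply: le_trans (xS [::] isT); rewrite big_nil.
rewrite -poweR_EFin; apply: gt0_ler_poweR.
- by rewrite invr_ge0 ltW.
- by rewrite in_itv /= leey andbT total_ge0.
- by rewrite in_itv /= leey andbT lee_fin.
apply: ge_ereal_sup => _ [X [finX _] <-].
rewrite fsbig_finite //= sumEFin lee_fin.
by apply: xS; exact: fset_uniq.
Qed.

(** Replaces the extended-real norm by a real total [S], to which the finite estimates apply. *)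
Lemma in_ellP x : in_ell p x -> exists S : R,
  [/\ 0 <= S, ell_norm p x = (S `^ p^-1)%:E,
      (forall s, uniq s -> psum x s <= S) &
      total x = S%:E].
Proof.
move=> /lty_poweRy => /(_ (invr_neq0 (lt0r_neq0 p_gt0))) => xfin.
have /fineK xE : total x \is a fin_num by rewrite ge0_fin_numE ?total_ge0.
exists (fine (total x)); split => //.
- exact/fine_ge0/total_ge0.
- by rewrite -poweR_EFin xE.
- by move=> s us; rewrite -lee_fin xE; exact: psum_le_total.
Qed.

Lemma in_ell_le x (S : R) : (forall s, uniq s -> psum x s <= S) -> in_ell p x.
Proof. by move=> /ell_norm_le xS; apply: le_lt_trans xS (ltry _). Qed.

Lemma ell_norm_ge0 x : (0 <= ell_norm p x)%E.
Proof. exact: poweR_ge0. Qed.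

Lemma ell_norm_supported x (s : seq T) : uniq s ->
  (forall i, i \notin s -> x i = 0) -> ell_norm p x = ((psum x s) `^ p^-1)%:E.
Proof.
move=> us xs; apply/eqP; rewrite eq_le psum_le_ell_norm // andbT.
apply: ell_norm_le => r ur; rewrite (bigID (mem s)) /= [X in _ + X]big1 ?addr0.
  have rs : perm_eq [seq i <- r | i \in s] [seq i <- s | i \in r].
    by apply: uniq_perm; rewrite ?filter_uniq // => i; rewrite !mem_filter andbC.
  rewrite -big_filter (perm_big _ rs) big_filter big_mkcond /=.
  by apply: ler_sum => i _; case: ifP => // _; exact: powR_ge0.
by move=> i /xs ->; rewrite Normc.normc0 powR0 ?gt_eqF.
Qed.

End EllNorm.

(** * Finite sets of naturals and their increasing enumerations *)

Section Subsets.
Variable n : nat.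
Implicit Types I : nsubset n.

Lemma nsubset_size I : size (sort leq (val I : {fset nat})) = n.
Proof. by rewrite size_sort; apply/eqP; exact: (valP I). Qed.

Lemma nsubset_nth_lt I i j : (i < j)%N -> (j < n)%N ->
  (nsubset_nth I i < nsubset_nth I j)%N.
Proof.
move=> ij jn; have srt : sorted ltn (sort leq (val I : {fset nat})).
  rewrite ltn_sorted_uniq_leq sort_uniq fset_uniq.
  exact: (sort_sorted leq_total).
apply: (sorted_ltn_nth ltn_trans) => //; rewrite inE nsubset_size //.
exact: ltn_trans jn.
Qed.

Lemma mem_nsubset I k :
  (k \in (val I : {fset nat})) = [exists i : 'I_n, k == nsubset_nth I i].
Proof.
rewrite -(mem_sort leq); apply/(nthP 0%N)/existsP => [[i + <-] | [i /eqP ->]].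
  by rewrite nsubset_size => i_lt; exists (Ordinal i_lt).
by exists i; rewrite ?nsubset_size.
Qed.

Lemma nsubset_nth_inj I I' :
  (forall i : 'I_n, nsubset_nth I i = nsubset_nth I' i) -> I = I'.
Proof.
move=> E; apply/val_inj/fsetP => k; rewrite !mem_nsubset.
by apply: eq_existsb => i; rewrite E.
Qed.

Lemma nsubset_of_increasing (h : nat -> nat) :
  (forall i j, (i < j)%N -> (j < n)%N -> (h i < h j)%N) ->
  exists I, forall i, (i < n)%N -> nsubset_nth I i = h i.
Proof.
move=> h_incr; pose s := [seq h i | i <- iota 0 n].
have s_sorted : sorted ltn s.
  apply/(sortedP 0%N) => i; rewrite size_map size_iota => i_lt.
  rewrite !(nth_map 0%N) ?size_iota ?(ltnW i_lt) // !nth_iota ?(ltnW i_lt) //.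
  by apply: h_incr.
have s_uniq : uniq s by apply: sorted_uniq s_sorted; [exact: ltn_trans|exact: ltnn].
have cs : #|` [fset x in s]%fset | == n.
  by rewrite card_fseq undup_id // size_map size_iota.
exists (exist (fun I : {fset nat} => #|` I|%fset == n) _ cs) => i i_lt; rewrite /nsubset_nth /=.
have -> : sort leq [fset x in s]%fset = s.
  apply: (irr_sorted_eq ltn_trans ltnn) => //.
    rewrite ltn_sorted_uniq_leq sort_uniq fset_uniq.
    exact: (sort_sorted leq_total).
  by move=> x; rewrite mem_sort inE.
by rewrite (nth_map 0%N) ?size_iota // nth_iota.
Qed.

End Subsets.

(** * Plücker coordinates compared with minors of truncated matrices *)

Section Truncation.
Variables (R : realType) (n : nat) (v : 'I_n -> nat -> R[i]).
Implicit Types (I : nsubset n) (p : R).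

Definition truncation N : 'I_n -> 'I_N -> R[i] := fun r k => v r k.

Lemma plucker_minor N I (g : {ffun 'I_n -> 'I_N}) :
  (forall i : 'I_n, nsubset_nth I i = g i) ->
  plucker v I = minor (@truncation N) g.
Proof.
by move=> E; congr (\det _); apply/matrixP => r i; rewrite !mxE /truncation E.
Qed.

(** Finitely many subsets lie in a common initial segment, where distinct subsets give distinct
    increasing maps. *)
Lemma sum_plucker_le p (s : seq (nsubset n)) : uniq s -> exists N,
  \sum_(I <- s) normc (plucker v I) `^ p <=
  \sum_(g | increasing g) normc (minor (@truncation N) g) `^ p.
Proof.
move=> us; pose N := (\sum_(I <- s) \sum_(i < n) nsubset_nth I i)%N.
have ltN I (i : 'I_n) : I \in s -> (nsubset_nth I i < N.+1)%N.
  move=> Is; rewrite ltnS /N (big_rem I) //= (bigD1 i) //= -addnA; exact: leq_addr.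
pose G I : {ffun 'I_n -> 'I_N.+1} := [ffun i : 'I_n => inord (nsubset_nth I i)].
have GE I (i : 'I_n) : I \in s -> nsubset_nth I i = G I i :> nat.
  by move=> Is; rewrite ffunE inordK // ltN.
have G_incr I : I \in s -> increasing (G I).
  by move=> Is; apply/increasingP => i j ij; rewrite -!GE // nsubset_nth_lt.
exists N.+1.
have uG : uniq [seq G J | J <- s].
  rewrite map_inj_in_uniq // => I I' Is I's /ffunP E.
  by apply: nsubset_nth_inj => i; rewrite (GE I) // (GE I') // E.
have -> : \sum_(I <- s) normc (plucker v I) `^ p =
    \sum_(g <- [seq G J | J <- s]) normc (minor (@truncation N.+1) g) `^ p.
  rewrite [RHS]big_map; apply: eq_big_seq => I Is.
  by rewrite (@plucker_minor _ _ (G I)) // => i; exact: GE.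
rewrite big_uniq //= [leLHS]big_mkcond [leRHS]big_mkcond /=.
apply: ler_sum => g _; case: ifP => [/mapP[I Is ->]|_].
  by rewrite G_incr.
by case: ifP => // _; exact: powR_ge0.
Qed.

Lemma sum_minor_plucker p N : exists2 s : seq (nsubset n), uniq s &
  \sum_(I <- s) normc (plucker v I) `^ p =
  \sum_(g | increasing g) normc (minor (@truncation N) g) `^ p.
Proof.
pose l := enum [pred g : {ffun 'I_n -> 'I_N} | increasing g].
have -> : \sum_(g | increasing g) normc (minor (@truncation N) g) `^ p =
    \sum_(g <- l) normc (minor (@truncation N) g) `^ p.
  by rewrite big_enum.
have l_incr : all (@increasing n N) l by apply/allP => g; rewrite mem_enum.
have : uniq l by exact: enum_uniq.
(* The induction also records that every subset in [s] comes from a map in [l], which keeps [s] free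
   of duplicates. *)
suff : uniq l -> exists2 s : seq (nsubset n), uniq s &
    \sum_(I <- s) normc (plucker v I) `^ p =
    \sum_(g <- l) normc (minor (@truncation N) g) `^ p /\
    {in s, forall I, exists2 g, g \in l & forall i : 'I_n, nsubset_nth I i = g i}.
  by move=> H /H [s us [E _]]; exists s.
elim: l l_incr => [|g l IH] /=; first by exists [::]; rewrite ?big_nil.
move=> /andP[g_incr /IH {}IH] /andP[gl /IH [s us [E sl]]].
(* The default [0] is harmless, because only indices below [n] are read. *)
pose h k := if insub k is Some i then val (g i) else 0%N.
have hE (i : 'I_n) : h i = g i by rewrite /h valK.
have [i j ij jn|I IE] := @nsubset_of_increasing n h.
  move/increasingP: g_incr.
  move=> /(_ (Ordinal (ltn_trans ij jn)) (Ordinal jn) ij).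
  by rewrite -(hE (Ordinal jn)) -(hE (Ordinal (ltn_trans ij jn))).
have {}IE (i : 'I_n) : nsubset_nth I i = g i by rewrite IE.
exists (I :: s) => /=.
  rewrite us andbT; apply: contra gl => /sl [g' g'l IE'].
  suff -> : g = g' by [].
  by apply/ffunP => i; apply/val_inj; rewrite /= -IE IE'.
split; first by rewrite !big_cons E (plucker_minor IE).
move=> J; rewrite inE => /predU1P[->|/sl [g' g'l ?]].
  by exists g; rewrite ?mem_head.
by exists g'; rewrite // inE g'l orbT.
Qed.

Lemma psum_truncation p r N : \sum_k normc (@truncation N r k) `^ p =
  \sum_(k <- iota 0 N) normc (v r k) `^ p.
Proof. by rewrite -[in RHS](subn0 N) -/(index_iota 0 N) big_mkord. Qed.

End Truncation.

(** Passage from matrices to sequences: each finite sum of coordinates is bounded through some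
    truncation, whose row sums are at most the full ones. *)
Lemma ell_norm_plucker_le (R : realType) (n : nat) (p K : R) :
  0 < p -> 0 <= K ->
  (forall N (V : 'I_n -> 'I_N -> R[i]),
    \sum_(g | increasing g) normc (minor V g) `^ p <=
    K * \prod_r \sum_k normc (V r k) `^ p) ->
  forall v : 'I_n -> nat -> R[i], (forall r, in_ell p (v r)) ->
  (ell_norm p (plucker v) <=
    (K `^ p^-1)%:E * \prod_(r < n) ell_norm p (v r))%E.
Proof.
move=> p0 K0 HV v v_ell.
have [S SP] := choice (fun r => in_ellP p0 (v_ell r)).
have S0 r : 0 <= S r by have [] := SP r.
have -> : (\prod_(r < n) ell_norm p (v r) = ((\prod_r S r) `^ p^-1)%:E)%E.
  rewrite powR_prod // -prodEFin.
  by apply: eq_bigr => r _; have [_ ->] := SP r.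
rewrite -EFinM -powRM ?prodr_ge0 //; apply: ell_norm_le => // s us.
have [N /le_trans] := sum_plucker_le v p us; apply.
apply: le_trans (HV _ _) _; apply: ler_wpM2l => //.
apply: ler_prod => r _; rewrite psum_truncation psum_ge0 /=.
by have [_ _ + _] := SP r; apply; exact: iota_uniq.
Qed.

(** * Upper bounds for sequences *)

Section MainBounds.
Variables (R : realType) (n : nat) (p : R).

Lemma ell_norm_plucker_ge_1 : 1 <= p ->
  forall v : 'I_n -> nat -> R[i], (forall r, in_ell p (v r)) ->
  (ell_norm p (plucker v) <=
    ((n`!%:R : R) `^ (1 - p^-1))%:E * \prod_(r < n) ell_norm p (v r))%E.
Proof.
move=> p1; have p0 : 0 < p := lt_le_trans ltr01 p1.
have -> : (n`!%:R : R) `^ (1 - p^-1) = ((n`!%:R : R) `^ (p - 1)) `^ p^-1.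
  by rewrite -powRrM mulrBl divff ?gt_eqF // mul1r.
apply: ell_norm_plucker_le; rewrite ?powR_ge0 // => N V.
exact: sum_minor_powR_ge_1.
Qed.

Lemma ell_norm_plucker_le_2 : 0 < p <= 2 ->
  forall v : 'I_n -> nat -> R[i], (forall r, in_ell p (v r)) ->
  (ell_norm p (plucker v) <= \prod_(r < n) ell_norm p (v r))%E.
Proof.
move=> /andP[p0 p2] v v_ell.
have := @ell_norm_plucker_le R n p 1 p0 ler01 _ v v_ell.
rewrite powR1 mul1e; apply => N V.
rewrite mul1r; have [p1|p1] := leP p 1; first by apply: sum_minor_powR_le_1; rewrite p0.
move: p2; rewrite le_eqVlt => /predU1P[->|p2].
  have sqrE (x : R[i]) : normc x `^ 2 = normc x ^+ 2.
    exact: (powR_mulrn 2 (normc_ge0 x)).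
  rewrite (eq_bigr (fun g => normc (minor V g) ^+ 2)) => [|g _]; last exact: sqrE.
  rewrite [leRHS](eq_bigr (fun r => \sum_k normc (V r k) ^+ 2)) => [|r _].
    exact: sum_minor_sqr_le.
  by apply: eq_bigr => k _; exact: sqrE.
by apply: sum_minor_powR_1_2; rewrite p1.
Qed.

End MainBounds.

(** * Frames supported on the first [n] indices, and lower bounds for admissible constants *)

Section SupportedFrames.
Variables (R : realType) (n : nat) (p : R) (p_gt0 : 0 < p).

(** An injective self-map of a finite set is onto, so [g] has the same image as the identity. *)
Lemma increasing_endo_id (g : {ffun 'I_n -> 'I_n}) :
  increasing g -> forall i, g i = i.
Proof.
move=> g_incr; have [h _ gh] := injF_bij (increasing_inj g_incr).
have -> : g = [ffun i => i]; last by move=> i; rewrite ffunE.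
apply: increasing_uniq => // [|i|i].
- by apply/increasingP => i j; rewrite !ffunE.
- by exists (g i); rewrite ffunE.
- by exists (h i); rewrite ffunE gh.
Qed.

(** A subset with an element outside the first [n] indices produces a zero column, so only the
    initial segment contributes. *)
Lemma ell_norm_plucker_supported (v : 'I_n -> nat -> R[i]) :
  (forall r k, (n <= k)%N -> v r k = 0) ->
  ell_norm p (plucker v) = (normc (\det (\matrix_(r < n, s < n) v r s)))%:E.
Proof.
move=> v_supp; have [//|I0 I0E] := @nsubset_of_increasing n id.
rewrite (@ell_norm_supported _ _ _ p_gt0 _ [:: I0]) //.
  rewrite big_seq1 -powRrM divff ?gt_eqF // powRr1 ?normc_ge0 //.
  congr (normc (\det _))%:E; apply/matrixP => i j.
  by rewrite !mxE I0E.
move=> I; rewrite inE => II0; apply/eqP; apply: contraR II0 => detI.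
have I_lt (i : 'I_n) : (nsubset_nth I i < n)%N.
  rewrite ltnNge; apply: contra detI => ni; rewrite /plucker -det_tr.
  by rewrite (expand_det_row _ i) big1 // => j _; rewrite !mxE v_supp ?mul0r.
pose g := [ffun i : 'I_n => Ordinal (I_lt i)].
have g_incr : increasing g.
  by apply/increasingP => i j ij; rewrite !ffunE /= nsubset_nth_lt.
apply/eqP/nsubset_nth_inj => i; rewrite I0E //.
by have := congr1 val (increasing_endo_id g_incr i); rewrite ffunE.
Qed.

Lemma ell_norm_std_unit r : ell_norm p (std_unit R r) = 1%E.
Proof.
rewrite (@ell_norm_supported _ _ _ p_gt0 _ [:: r]) //.
  by rewrite big_seq1 /std_unit eqxx Normc.normc1 !powR1.
by move=> k; rewrite inE /std_unit => /negbTE ->.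
Qed.

Lemma ell_norm_plucker_std_unit :
  ell_norm p (plucker (fun r : 'I_n => std_unit R r)) = 1%E.
Proof.
rewrite ell_norm_plucker_supported; last first.
  by move=> r k nk; rewrite /std_unit gtn_eqF // (leq_trans _ nk).
rewrite (_ : \matrix_(r, s) _ = 1%:M) ?det1 ?Normc.normc1 //.
by apply/matrixP => i j; rewrite !mxE /std_unit eq_sym.
Qed.

Lemma admissible_const_ge_1 (C : R) : admissible_const n p C -> 1 <= C.
Proof.
move=> /(_ (fun r => std_unit R r)); rewrite ell_norm_plucker_std_unit big1.
  rewrite mule1 lee_fin; apply => r.
  by rewrite /in_ell ell_norm_std_unit ltry.
by move=> r _; rewrite ell_norm_std_unit.
Qed.

(** The test frame consists of the rows of [M] padded by zeros. Each has norm n^(1/p), and the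
    factor beside the determinant is the inverse of the product of these norms. *)
Lemma sign_det_le (C : R) (M : 'M[R]_n) : (0 < n)%N ->
  admissible_const n p C -> sign_mx M ->
  `|\det M| * n%:R `^ (- (n%:R / p)) <= C.
Proof.
move=> n_gt0 C_adm M_sign.
pose v (r : 'I_n) (k : nat) : R[i] :=
  if insub k is Some i then ((M r i)%:C)%C else 0.
have v_val r (i : 'I_n) : v r i = ((M r i)%:C)%C by rewrite /v valK.
have v_supp r k : (n <= k)%N -> v r k = 0.
  by move=> nk; rewrite /v insubF // ltnNge nk.
have v_norm r : ell_norm p (v r) = (n%:R `^ p^-1)%:E.
  rewrite (@ell_norm_supported _ _ _ p_gt0 _ (iota 0 n)) ?iota_uniq //; last first.
    by move=> k; rewrite mem_iota add0n /= -leqNgt; exact: v_supp.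
  congr ((_ `^ _)%:E); rewrite -[in LHS](subn0 n) -/(index_iota 0 n) big_mkord.
  rewrite (eq_bigr (fun=> 1)) ?sumr_const ?card_ord // => i _.
  rewrite v_val normc_real.
  by have [->|->] := M_sign r i; rewrite ?normrN normr1 powR1.
have := C_adm v _; rewrite (ell_norm_plucker_supported v_supp).
have -> : \matrix_(r < n, s < n) v r s = map_mx (real_complex R) M.
  by apply/matrixP => i j; rewrite !mxE v_val.
rewrite det_map_mx normc_real (eq_bigr (fun=> (n%:R `^ p^-1)%:E)) // prodEFin.
rewrite prodr_const card_ord -EFinM lee_fin => /(_ _) H.
have {}H : `|\det M| <= C * (n%:R `^ p^-1) ^+ n.
  by apply: H => r; rewrite /in_ell v_norm ltry.
rewrite powRN ler_pdivrMr ?powR_gt0 ?ltr0n //.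
by rewrite [n%:R / p]mulrC powRrM powR_mulrn ?powR_ge0.
Qed.

End SupportedFrames.

Lemma hadamard_det (R : realType) (n : nat) (H : 'M[R]_n) : hadamard_mx H ->
  `|\det H| = n%:R `^ (n%:R / 2).
Proof.
move=> [_ HH]; have := congr1 determinant HH.
rewrite det_mulmx det_tr det_scalar -expr2 => dH.
rewrite powRrM powR12_sqrt ?powR_ge0 // powR_mulrn // -dH.
by rewrite sqrtr_sqr.
Qed.

(** * Sharpness of the exponent: sequences constant on dyadic blocks *)

Section DyadicBlocks.
Variable R : realType.

Lemma sum_seq_subset (T : eqType) (F : T -> R) (s t : seq T) :
  (forall i, 0 <= F i) -> uniq s -> uniq t -> {subset s <= t} ->
  \sum_(i <- s) F i <= \sum_(i <- t) F i.
Proof.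
move=> F0 us ut st; have st_perm : perm_eq s [seq i <- t | i \in s].
  apply: uniq_perm; rewrite ?filter_uniq // => i; rewrite mem_filter.
  by case: (boolP (i \in s)) => // /st ->.
rewrite (perm_big _ st_perm) big_filter big_mkcond /=.
by apply: ler_sum => i _; case: ifP.
Qed.

Lemma seq_nat_bound (s : seq nat) : exists N, {subset s <= iota 0 N}.
Proof.
exists (\sum_(k <- s) k).+1%N => k ks.
by rewrite mem_iota add0n ltnS (big_rem k) //= leq_addr.
Qed.

(** The indices with [trunc_log 2 k.+1 = j] are the [2 ^ j] consecutive ones from [2 ^ j - 1] on;
    the shift by one keeps the logarithm away from zero. *)
Lemma sum_dyadic_blocks (g : nat -> R) (J : nat) :
  \sum_(0 <= k < (2 ^ J).-1) g (trunc_log 2 k.+1) =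
  \sum_(j < J) 2 ^+ j * g j.
Proof.
elim: J => [|J IH]; first by rewrite big_ord0 big_geq.
have le1 : ((2 ^ J).-1 <= (2 ^ J.+1).-1)%N.
  by rewrite -!subn1 leq_sub2r // leq_exp2l.
rewrite big_ord_recr -IH (big_cat_nat (leq0n _) le1) //=; congr (_ + _).
rewrite (eq_big_nat _ _ (F2 := fun=> g J)) => [|k /andP[lk kl]]; last first.
  congr g; apply: trunc_log_eq => //.
  rewrite -ltnS prednK ?expn_gt0 // in lk; rewrite lk /=.
  by rewrite -(prednK (_ : 0 < 2 ^ J.+1)%N) ?expn_gt0 // ltnS.
rewrite sumr_const_nat -natrX mulr_natl; congr (_ *+ _).
by rewrite expnS mul2n -addnn; have := expn_gt0 2 J; lia.
Qed.
End DyadicBlocks.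

Section SharpExponent.
Variables (R : realType) (q : R) (q_gt0 : 0 < q).

(* Takes the value [2 ^ (- j / q)] on a block of [2 ^ j] consecutive
   indices. *)
Definition dyadic_decay (k : nat) : R[i] :=
  (((2 `^ (- q^-1)) ^+ trunc_log 2 k.+1)%:C)%C.

(** The ratio is below one for [s > q], which gives summability, and equal to one for [s = q], where
    every block contributes [1]. *)
Lemma psum_dyadic_decay (s : R) (J : nat) :
  \sum_(k <- iota 0 (2 ^ J).-1) normc (dyadic_decay k) `^ s =
  \sum_(j < J) (2 `^ (1 - s / q)) ^+ j.
Proof.
have b0 : 0 <= 2 `^ (- q^-1) :> R by exact: powR_ge0.
have -> : iota 0 (2 ^ J).-1 = index_iota 0 (2 ^ J).-1 by rewrite /index_iota subn0.
have := sum_dyadic_blocks (fun j => ((2 `^ (- q^-1)) ^+ j) `^ s) J.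
have -> : \sum_(j < J) 2 ^+ j * ((2 `^ (- q^-1)) ^+ j) `^ s =
    \sum_(j < J) (2 `^ (1 - s / q)) ^+ j.
  apply: eq_bigr => j _.
  rewrite powRD; last by rewrite pnatr_eq0 implybT.
  rewrite powRr1 // exprMn; congr (_ * _).
  by rewrite -powR_exprn // -powRrM; congr (_ `^ _ ^+ _); ring.
move=> <-; apply: eq_bigr => k _.
by rewrite /dyadic_decay normc_real ger0_norm // exprn_ge0.
Qed.

Lemma dyadic_decay_in_ell (p : R) : q < p -> in_ell p dyadic_decay.
Proof.
move=> qp; have p0 : 0 < p := lt_trans q_gt0 qp.
pose rho : R := 2 `^ (1 - p / q).
have rho0 : 0 < rho by rewrite powR_gt0.
have rho1 : rho < 1.
  have e0 : 0 < p / q - 1 by rewrite subr_gt0 ltr_pdivlMr // mul1r.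
  have -> : rho = (2 `^ (p / q - 1))^-1 by rewrite -powRN opprB.
  rewrite invf_lt1 ?powR_gt0 //.
  have := @gt0_ltr_powR R _ e0 1 2; rewrite !nnegrE powR1.
  by apply; rewrite // ltr1n.
apply: (in_ell_le p0 (S := (1 - rho)^-1)) => s us.
have [N sN] := seq_nat_bound s.
apply: (@le_trans _ _ (\sum_(k <- iota 0 (2 ^ N).-1) normc (dyadic_decay k) `^ p)).
  apply: sum_seq_subset; rewrite ?iota_uniq // => k; first exact: powR_ge0.
  move=> /sN.
  rewrite !mem_iota !add0n /= => kN; apply: leq_trans kN _.
  by rewrite -ltnS prednK ?expn_gt0 // ltn_expl.
rewrite psum_dyadic_decay -/rho.
have r1 : 0 < 1 - rho by rewrite subr_gt0.
rewrite -(ler_pM2l r1) divff ?gt_eqF //.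
have -> : (1 - rho) * \sum_(j < N) rho ^+ j = 1 - rho ^+ N.
  by rewrite -[RHS]opprB subrX1 -mulNr opprB.
by rewrite lerBlDr lerDl exprn_ge0 // ltW.
Qed.

(** All rows but the last are unit vectors, so for [k >= m] the coordinate at {0, ..., m-1, k} is
    the [k]-th entry of the last row, whose [q]-th powers have infinite sum. *)
Lemma exists_plucker_notin_ell (n : nat) (p : R) : (0 < n)%N -> q < p ->
  exists v : 'I_n -> nat -> R[i],
    (forall r, in_ell p (v r)) /\ ~ in_ell q (plucker v).
Proof.
case: n => // m _ qp; have p0 : 0 < p := lt_trans q_gt0 qp.
pose v (r : 'I_m.+1) : nat -> R[i] :=
  if (r < m)%N then std_unit R r else dyadic_decay.
exists v; split.
  move=> r; rewrite /v; case: ifP => _; last exact: dyadic_decay_in_ell.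
  by rewrite /in_ell ell_norm_std_unit ?ltry.
(* For [k < m] any subset will do; the implication makes the choice total in [k]. *)
have exI k : exists J : nsubset m.+1, (m <= k)%N ->
    forall i, (i < m.+1)%N -> nsubset_nth J i = if (i < m)%N then i else k.
  have [mk|km] := leqP m k; last first.
    by have [//|J _] := @nsubset_of_increasing m.+1 id; exists J.
  have [i j ij jm|J JE] := @nsubset_of_increasing m.+1
      (fun i => if (i < m)%N then i else k); last by exists J.
  have im : (i < m)%N by rewrite -ltnS (leq_trans _ jm).
  by rewrite im; case: ifP => // _; apply: leq_trans mk.
have {exI}[I IE] := choice exI.
have pluckerI k : (m <= k)%N -> plucker v (I k) = dyadic_decay k.
  move=> mk; rewrite /plucker det_trig.
    rewrite big_ord_recr /= big1 ?mul1r => [|i _].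
      by rewrite mxE IE // /v /= ltnn.
    have i_lt : (i < m.+1)%N := ltnW (ltn_ord i).
    by rewrite mxE IE //= /v /= (ltn_ord i) /std_unit eqxx.
  apply/is_trig_mxP => i j ij; rewrite mxE IE //.
  have im : (i < m)%N by apply: leq_trans ij _; rewrite -ltnS; exact: ltn_ord.
  rewrite /v im /std_unit; case: ifP => _; first by rewrite gtn_eqF.
  by rewrite gtn_eqF // (leq_trans im).
move=> /(in_ellP q_gt0) [S [S0 _ S_bound _]].
pose X := \sum_(k <- iota 0 m) normc (dyadic_decay k) `^ q.
have X0 : 0 <= X by exact: psum_ge0.
(* The first [J] blocks contribute exactly [J]; the entries below [m], which the subsets [I k] do
   not capture, cost only the fixed amount [X]. *)
have bound J : J%:R <= X + S.
  have -> : J%:R = \sum_(k <- iota 0 (2 ^ J).-1) normc (dyadic_decay k) `^ q.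
    rewrite psum_dyadic_decay divff ?gt_eqF // subrr powRr0.
    by rewrite (eq_bigr (fun=> 1)) ?sumr_const ?card_ord // => j _; rewrite expr1n.
  set M := (2 ^ J).-1.
  apply: (@le_trans _ _ (\sum_(k <- iota 0 m ++ iota m M) normc (dyadic_decay k) `^ q)).
    rewrite -iotaD; apply: sum_seq_subset; rewrite ?iota_uniq // => k.
      exact: powR_ge0.
    by rewrite !mem_iota !add0n /= => /leq_trans; apply; exact: leq_addl.
  rewrite big_cat lerD //.
  have -> : \sum_(k <- iota m M) normc (dyadic_decay k) `^ q =
      \sum_(J <- [seq I k | k <- iota m M]) normc (plucker v J) `^ q.
    rewrite [RHS]big_map; apply: eq_big_seq => k; rewrite mem_iota => /andP[mk _].
    by rewrite pluckerI.
  apply: S_bound; rewrite map_inj_in_uniq ?iota_uniq // => k l.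
  rewrite !mem_iota => /andP[mk _] /andP[ml _] Ikl.
  by have := IE k mk m (ltnSn m); rewrite Ikl IE // ltnn.
have := bound (Num.trunc (X + S)).+1; rewrite leNgt => /negP; apply.
by rewrite Num.Theory.truncnS_gt.
Qed.

End SharpExponent.

(** * Orthonormal frames at exponent two, through limits of truncated Gram matrices *)

Lemma cvg_det (K : numFieldType) (n : nat) (G : nat -> 'M[K]_n) (L : 'M[K]_n) :
  (forall r s, (fun m => G m r s : K^o) @ \oo --> (L r s : K^o)) ->
  (fun m => \det (G m) : K^o) @ \oo --> (\det L : K^o).
Proof.
move=> GL.
have cvgP (s : 'S_n) : (fun m => \prod_r G m r (s r) : K^o) @ \oo -->
    (\prod_r L r (s r) : K^o).
  elim: (index_enum _) => [|r rs IH].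
    under eq_fun do rewrite big_nil.
    by rewrite big_nil; exact: cvg_cst.
  under eq_fun do rewrite big_cons.
  by rewrite big_cons; apply: cvgM.
rewrite /determinant; elim: (index_enum _) => [|s ss IH].
  under eq_fun do rewrite big_nil.
  by rewrite big_nil; exact: cvg_cst.
under eq_fun do rewrite big_cons.
rewrite big_cons; apply: cvgD => //.
by apply: cvgM => //; exact: cvg_cst.
Qed.

Section Orthonormal.
Variable R : realType.

Lemma cvg_real_part (u : nat -> R) (l : R) :
  (fun m => ((u m)%:C)%C : R[i]^o) @ \oo --> (((l)%:C)%C : R[i]^o) ->
  u @ \oo --> l.
Proof.
move=> /cvgrPdist_lt H; apply/cvgrPdist_lt => e e0.
have e0C : 0 < ((e)%:C)%C by rewrite ltcR.
have := H _ e0C; apply: filterS => m.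
by rewrite -rmorphB /= normc_norm normc_real ltcR.
Qed.

Lemma le_of_cvg (u : nat -> R) (l b : R) :
  u @ \oo --> l -> (forall m, u m <= b) -> l <= b.
Proof.
move=> ul ub; rewrite -(cvg_lim _ ul) //; apply: limr_le.
  by apply/cvg_ex; exists l.
by near=> m; exact: ub.
Unshelve. all: by end_near. Qed.

Variables (n : nat) (v : 'I_n -> nat -> R[i]).
Hypotheses (v_ell : forall r, in_ell 2 (v r)) (v_orth : orthonormal_frame v).

Lemma psum_orthonormal_cvg r :
  (fun N => \sum_(k <- iota 0 N) normc (v r k) `^ 2) @ \oo --> (1 : R).
Proof.
apply: cvg_real_part; have := v_orth; rewrite /orthonormal_frame => /(_ r r); rewrite eqxx.
apply: cvg_trans.
apply: near_eq_cvg; apply: nearW => N.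
rewrite /series /= rmorph_sum /index_iota subn0; apply: eq_bigr => k _.
by rewrite powR_mulrn ?normc_ge0 //= normc_sqr.
Qed.

Lemma ell_norm_orthonormal r : ell_norm 2 (v r) = 1%E.
Proof.
have two_gt0 : 0 < 2 :> R by [].
have [S [S0 -> S_bound tot]] := in_ellP two_gt0 (v_ell r).
suff -> : S = 1 by rewrite powR1.
apply/eqP; rewrite eq_le; apply/andP; split.
  rewrite -lee_fin -tot; apply: ge_ereal_sup => _ [X [finX _] <-].
  rewrite fsbig_finite //= sumEFin lee_fin.
  have [N sN] := seq_nat_bound (fset_set X).
  apply: le_trans (sum_seq_subset _ (fset_uniq _) (iota_uniq 0 N) sN) _.
    by move=> k; exact: powR_ge0.
  pose u N := \sum_(k <- iota 0 N) normc (v r k) `^ 2.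
  have u_cvg : u @ \oo --> (1 : R) := psum_orthonormal_cvg r.
  have u_lim : limn u = 1 by apply: cvg_lim.
  (* [u] increases to its limit [1], so each initial sum, and with it each finite sum, is at most
     [1]. *)
  suff u_mono : {homo u : a b / (a <= b)%N >-> a <= b}.
    rewrite -/(u N) -u_lim; apply: (nondecreasing_cvgn_le u_mono).
    by apply/cvg_ex; exists 1.
  move=> a b ab; apply: sum_seq_subset; rewrite ?iota_uniq // => k.
    exact: powR_ge0.
  by rewrite !mem_iota !add0n /= => /leq_trans; apply.
by apply: (le_of_cvg (psum_orthonormal_cvg r)) => N; apply: S_bound; exact: iota_uniq.
Qed.

(** Only the lower bound is new: by Cauchy-Binet the squared minors of a truncation sum to its Gram
    determinant, which tends to the determinant of the identity. *)
Lemma ell_norm_plucker_orthonormal : ell_norm 2 (plucker v) = 1%E.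
Proof.
have two_gt0 : 0 < 2 :> R by [].
have prod1 : (\prod_(r < n) ell_norm 2 (v r) = 1)%E.
  by rewrite big1 // => r _; exact: ell_norm_orthonormal.
have le1 : (ell_norm 2 (plucker v) <= 1)%E.
  by rewrite -prod1; apply: ell_norm_plucker_le_2; rewrite ?two_gt0 ?lexx.
apply/eqP; rewrite eq_le le1 /=.
have [S [S0 -> S_bound _]] := in_ellP two_gt0 (le_lt_trans le1 (ltry 1)).
suff S1 : 1 <= S.
  have := ge0_ler_powR (_ : 0 <= 2^-1) (ler01 : 1 \is Num.nneg) S0 S1.
  by rewrite powR1 lee_fin; apply; rewrite invr_ge0.
have D_cvg : (fun N => \sum_(g | increasing g)
    normc (minor (truncation v (N := N)) g) ^+ 2) @ \oo --> (1 : R).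
  apply: cvg_real_part; under eq_fun do rewrite conj_sum_sqr.
  have -> : ((1)%:C)%C = \det (1%:M : 'M[R[i]]_n) by rewrite det1.
  apply: (@cvg_det _ n (fun N => \matrix_(r, s) \sum_k
    truncation v (N := N) r k * Num.conj (truncation v (N := N) s k))) => r s.
  have := v_orth; rewrite /orthonormal_frame => /(_ r s); rewrite mxE; apply: cvg_trans.
  apply: near_eq_cvg; apply: nearW => N.
  by rewrite mxE /series /= big_mkord.
apply: (le_of_cvg D_cvg) => N.
have [s us E] := sum_minor_plucker v 2 N.
have -> : \sum_(g | increasing g) normc (minor (truncation v (N := N)) g) ^+ 2 =
    \sum_(I <- s) normc (plucker v I) `^ 2.
  by rewrite E; apply: eq_bigr => g _; rewrite powR_mulrn ?normc_ge0.
exact: S_bound.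
Qed.

End Orthonormal.

(** * Existence of the optimal constant, and its value up to exponent two *)

Section OptimalConstant.
Variables (R : realType) (n : nat) (p : R) (p_gt0 : 0 < p).

Lemma exists_admissible_const : exists C : R, admissible_const n p C.
Proof.
have [p1|p1] := leP 1 p.
  by exists (n`!%:R `^ (1 - p^-1)) => v v_ell; exact: ell_norm_plucker_ge_1.
exists 1 => v v_ell; rewrite mul1e; apply: ell_norm_plucker_le_2 => //.
by rewrite p_gt0 (le_trans (ltW p1)) // ler1n.
Qed.

(** The infimum is itself admissible: for a fixed frame with nonzero product [Q] of norms,
    admissibility bounds the constant below by a quotient, and such bounds pass to the infimum. *)
Lemma exists_optimal_const : exists C : R, optimal_const n p C.
Proof.
have [c0 c0_adm] := exists_admissible_const.
have adm_lb : has_lbound (admissible_const n p).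
  by exists 1 => c; exact: admissible_const_ge_1.
exists (inf (admissible_const n p)); split; last first.
  by move=> c c_adm; exact: ge_inf.
move=> v v_ell; have [S SP] := choice (fun r => in_ellP p_gt0 (v_ell r)).
pose Q := \prod_r (S r `^ p^-1).
have QE : (\prod_(r < n) ell_norm p (v r) = Q%:E)%E.
  by rewrite -prodEFin; apply: eq_bigr => r _; have [_ ->] := SP r.
have Q0 : 0 <= Q by rewrite prodr_ge0 // => r _; exact: powR_ge0.
have adm_le c : admissible_const n p c -> (ell_norm p (plucker v) <= (c * Q)%:E)%E.
  by move=> /(_ v v_ell); rewrite QE EFinM.
rewrite QE -EFinM; have := adm_le _ c0_adm.
have [x xE] : exists x : R, ell_norm p (plucker v) = x%:E.
  exists (fine (ell_norm p (plucker v))); rewrite fineK //.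
  rewrite ge0_fin_numE ?ell_norm_ge0 //.
  exact: le_lt_trans (adm_le _ c0_adm) (ltry _).
rewrite xE in adm_le *; rewrite !lee_fin.
have [->|Qn0] := eqVneq Q 0; first by rewrite !mulr0.
have Qpos : 0 < Q by rewrite lt0r Qn0.
move=> _; rewrite -ler_pdivrMr //; apply: lb_le_inf; first by exists c0.
by move=> c /adm_le; rewrite lee_fin ler_pdivrMr.
Qed.

Lemma optimal_const_eq_1 (C : R) : p <= 2 -> optimal_const n p C -> C = 1.
Proof.
move=> p2 [C_adm C_lb]; apply/eqP; rewrite eq_le (admissible_const_ge_1 p_gt0 C_adm).
rewrite andbT; apply: C_lb => v v_ell.
by rewrite mul1e; apply: ell_norm_plucker_le_2; rewrite ?p_gt0.
Qed.

End OptimalConstant.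

Theorem theorem2p1 (R : realType) (n : nat) (p : R) (hn : (1 <= n)%N)
    (hp : 0 < p) :
  exists C : R, optimal_const n p C
  /\ (forall v : 'I_n -> nat -> R[i], (forall r, in_ell p (v r)) ->
        in_ell p (plucker v))
  (* (a) *)
  /\ (1 <= p -> forall v : 'I_n -> nat -> R[i], (forall r, in_ell p (v r)) ->
        (ell_norm p (plucker v) <=
         ((n`!%:R : R) `^ (1 - p^-1))%:E * \prod_(r < n) ell_norm p (v r))%E)
  (* (b) *)
  /\ (p <= 1 \/ p = 2 ->
        C = 1 /\
        forall v : 'I_n -> nat -> R[i], (forall r, in_ell p (v r)) ->
          (ell_norm p (plucker v) <= \prod_(r < n) ell_norm p (v r))%E)
  /\ (ell_norm p (plucker (fun r : 'I_n => std_unit R r)) =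
        \prod_(r < n) ell_norm p (std_unit R r))%E
  /\ (p = 2 -> forall v : 'I_n -> nat -> R[i], (forall r, in_ell p (v r)) ->
        orthonormal_frame v ->
        (ell_norm p (plucker v) = \prod_(r < n) ell_norm p (v r))%E)
  (* (c) *)
  /\ (1 <= p <= 2 -> C = 1)
  (* (d) *)
  /\ (2 < p ->
        ((exists H : 'M[R]_n, hadamard_mx H) ->
           (n%:R : R) `^ (n%:R * (2^-1 - p^-1)) <= C
           /\ ((1 < n)%N -> 1 < (n%:R : R) `^ (n%:R * (2^-1 - p^-1))))
        /\ max_sign_det R n * (n%:R : R) `^ (- (n%:R / p)) <= C)
  (* (e) *)
  /\ (forall q : R, 0 < q < p ->
        exists v : 'I_n -> nat -> R[i],
          (forall r, in_ell p (v r)) /\ ~ in_ell q (plucker v)).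
Proof.
have [C C_opt] := exists_optimal_const n hp; have [C_adm C_lb] := C_opt.
have sharp : p <= 2 -> forall v : 'I_n -> nat -> R[i],
    (forall r, in_ell p (v r)) ->
    (ell_norm p (plucker v) <= \prod_(r < n) ell_norm p (v r))%E.
  by move=> p2; apply: ell_norm_plucker_le_2; rewrite hp.
have small : p <= 1 \/ p = 2 -> p <= 2.
  by case=> [p1|->//]; apply: le_trans p1 _; rewrite ler1n.
have sign_le (M : 'M[R]_n) : sign_mx M ->
    `|\det M| * (n%:R : R) `^ (- (n%:R / p)) <= C by exact: sign_det_le.
have n_gt0 : 0 < n%:R :> R by rewrite ltr0n.
exists C; split; first exact: C_opt.
split.
  move=> v v_ell; apply: le_lt_trans (C_adm v v_ell) _.
  have [S SP] := choice (fun r => in_ellP hp (v_ell r)).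
  rewrite (eq_bigr (fun r => (S r `^ p^-1)%:E)) => [|r _]; last by have [_ ->] := SP r.
  by rewrite prodEFin -EFinM ltry.
split; first by move=> p1; exact: ell_norm_plucker_ge_1.
split.
  by move=> /small p2; split; [exact: optimal_const_eq_1 C_opt|exact: sharp].
split.
  rewrite ell_norm_plucker_std_unit // big1 // => r _.
  exact: ell_norm_std_unit.
split.
  move=> p2; subst p => v v_ell v_orth.
  rewrite ell_norm_plucker_orthonormal // big1 // => r _.
  exact: ell_norm_orthonormal.
split; first by move=> /andP[_ p2]; exact: optimal_const_eq_1 C_opt.
split; last first.
  by move=> q /andP[q0 qp]; exact: exists_plucker_notin_ell.
move=> p2; split.
  move=> [H H_had]; split.
    have := sign_le H (proj1 H_had); rewrite hadamard_det //.
    rewrite -powRD; last by rewrite (gt_eqF n_gt0) implybT.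
    by congr (_ `^ _ <= _); rewrite mulrBr.
  move=> n1.
  have e0 : 0 < n%:R * (2^-1 - p^-1) by rewrite mulr_gt0 // subr_gt0 ltf_pV2 ?posrE.
  have := @gt0_ltr_powR R _ e0 1 n%:R; rewrite !nnegrE powR1.
  by apply; rewrite ?ltr1n // ltW.
(* The all-ones matrix shows that the set of determinants is nonempty, as bounding its supremum
   requires. *)
rewrite -ler_pdivlMr ?powR_gt0 //; apply: ge_sup.
  by exists (\det (const_mx 1 : 'M[R]_n)), (const_mx 1) => //= i j; left; rewrite mxE.
move=> _ [M M_sign <-]; rewrite ler_pdivlMr ?powR_gt0 //.
apply: le_trans (sign_le M M_sign); apply: ler_wpM2r; first exact: powR_ge0.
exact: ler_norm.
Qed.
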